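(* Let $\mathfrak{A}_1,\mathfrak{A}_2$ be two $*$-algebras containing the C$^*$-algebra $\mathfrak{B}$, each endowed with two positive conditional expectations $\Phi_j,\Psi_j:\mathfrak{A}_j\to\mathfrak{B}$, $j=1,2$, and let $(\mathfrak{A},\Phi,\Psi)$ be the conditionally free product with amalgamation over $\mathfrak{B}$ of the triples $(\mathfrak{A}_1,\Phi_1,\Psi_1)$ and $(\mathfrak{A}_2,\Phi_2,\Psi_2)$. Then $\Phi$ and $\Psi$ are positive, i.e. $\Phi(a^*a)\ge0$ and $\Psi(a^*a)\ge0$ for all $a\in\mathfrak{A}$.
   Context: A conditional expectation $\Theta$ from an algebra containing $\mathfrak{B}$ onto $\mathfrak{B}$ is a linear map with $\Theta(b_1xb_2)=b_1\Theta(x)b_2$ for $b_1,b_2\in\mathfrak{B}$ and $\Theta(b)=b$ for $b\in\mathfrak{B}$; it is positive if $\Theta(x^*x)\ge0$ for all $x$. The conditionally free product with amalgamation over $\mathfrak{B}$ of $(\mathfrak{A}_1,\Phi_1,\Psi_1)$ and $(\mathfrak{A}_2,\Phi_2,\Psi_2)$ is $(\mathfrak{A},\Phi,\Psi)$, where $\mathfrak{A}=\mathfrak{A}_1*_{\mathfrak{B}}\mathfrak{A}_2$ is the algebraic free product with amalgamation over $\mathfrak{B}$ (with its natural involution), and $\Psi=\Psi_1*_{\mathfrak{B}}\Psi_2$, $\Phi=\Phi_1*_{(\Psi_1,\Psi_2)}\Phi_2$ are the conditional expectations $\mathfrak{A}\to\mathfrak{B}$ determined by $$\Psi(a_1a_2\cdots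 a_n)=0,\qquad \Phi(a_1a_2\cdots a_n)=\Phi_{\varepsilon(1)}(a_1)\Phi_{\varepsilon(2)}(a_2)\cdots\Phi_{\varepsilon(n)}(a_n)$$ for all $n\ge1$ and all $a_i\in\mathfrak{A}_{\varepsilon(i)}$, $\varepsilon(i)\in\{1,2\}$, with $\varepsilon(1)\ne\varepsilon(2)\ne\cdots\ne\varepsilon(n)$ (consecutive indices distinct) and $\Psi_{\varepsilon(i)}(a_i)=0$ for all $i$. *)

(* Defs.v *)
(* Algebras are not assumed to be unital: neither the C*-algebra nor the
   *-algebras containing it need have a unit.  The algebra structures of ssralg
   are all unital, whence the small hierarchy below.  If the algebras at hand
   are unital with a common unit, their amalgam in the category of possibly
   non-unital algebras is the usual unital one. *)
From HB Require Import structures.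
From mathcomp Require Import all_boot all_order all_algebra.
From mathcomp Require Import complex.
From mathcomp Require Import boolp classical_sets reals topology normedtype.

Set Implicit Arguments.
Unset Strict Implicit.
Unset Printing Implicit Defensive.

Import Order.TTheory GRing.Theory Num.Theory.
Import numFieldNormedType.Exports.

Local Open Scope ring_scope.

Reserved Notation "x ** y" (at level 40, left associativity).

HB.mixin Record Lmodule_isNUAlgebra (K : pzRingType) A of GRing.Lmodule K A := {
  numul : A -> A -> A;
  numulA : associative numul;
  numulDl : left_distributive numul +%R;
  numulDr : right_distributive numul +%R;
  nuscaleAl : forall (k : K) (x y : A), k *: numul x y = numul (k *: x) y;
  nuscaleAr : forall (k : K) (x y : A), k *: numul x y = numul x (k *: y)
}.

#[short(type="nuAlgType")]
HB.structure Definition NUAlgebra (K : pzRingType) :=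
  { A of GRing.Lmodule K A & Lmodule_isNUAlgebra K A }.

Notation "x ** y" := (numul x y) : ring_scope.

HB.mixin Record NUAlgebra_isStar (K : numClosedFieldType) A
    of NUAlgebra K A := {
  star : A -> A;
  starK : involutive star;
  starD : {morph star : x y / x + y};
  starZ : forall (k : K) (x : A), star (k *: x) = k^* *: star x;
  starM : forall x y : A, star (x ** y) = star y ** star x
}.

#[short(type="starAlgType")]
HB.structure Definition StarAlgebra (K : numClosedFieldType) :=
  { A of NUAlgebra K A & NUAlgebra_isStar K A }.

HB.mixin Record isCStar (K : numClosedFieldType) A
    of StarAlgebra K A & CompleteNormedModule K A := {
  norm_numul : forall x y : A, `|x ** y| <= `|x| * `|y|;
  norm_star_mul : forall x : A, `|star x ** x| = `|x| ^+ 2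
}.

(* The norm takes its values in K, and a C*-algebra in the usual sense is
   obtained for K = R[i], with R the field of real numbers. *)
#[short(type="cstarAlgType")]
HB.structure Definition CStarAlgebra (K : numClosedFieldType) :=
  { A of StarAlgebra K A & CompleteNormedModule K A & isCStar K A }.

(* Positivity in a C*-algebra, in the form that needs no unit: the positive
   elements are those of the form c^* c. *)
Definition cstar_ge0 (K : numClosedFieldType) (B : cstarAlgType K) (b : B) :=
  exists c : B, b = star c ** c.

Definition alg_hom (K : pzRingType) (A D : nuAlgType K) (f : A -> D) :=
  linear f /\ {morph f : x y / x ** y}.

Definition star_hom (K : numClosedFieldType) (A D : starAlgType K)
    (f : A -> D) :=
  alg_hom f /\ {morph f : x / star x}.

(* An inclusion of *-algebras. *)
Definition star_embedding (K : numClosedFieldType) (B A : starAlgType K)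
    (f : B -> A) :=
  star_hom f /\ injective f.

Section CondExp.
Variables (K : numClosedFieldType) (B : cstarAlgType K) (A : starAlgType K).
Variable beta : B -> A.

Definition cond_exp (Theta : A -> B) :=
  [/\ linear Theta,
      forall (b1 b2 : B) (x : A),
        Theta (beta b1 ** x ** beta b2) = b1 ** Theta x ** b2
    & forall b : B, Theta (beta b) = b].

Definition positive_map (Theta : A -> B) :=
  forall x : A, cstar_ge0 (Theta (star x ** x)).

End CondExp.

(* The product of the nonempty word x :: s. *)
Definition word_prod (K : pzRingType) (A : nuAlgType K) (x : A) (s : seq A) : A :=
  foldl (fun y z => y ** z) x s.

(* The two algebras are indexed by bool, a set with two elements. *)
Section FreeProduct.
Variables (K : numClosedFieldType) (B : cstarAlgType K).
Variables (A_ : bool -> starAlgType K) (beta : forall j, B -> A_ j).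

(* The algebraic free product with amalgamation over B is the pushout of the
   beta j in the category of algebras; its natural involution is the one for
   which the canonical maps iota j are *-homomorphisms. *)
Definition is_amalgamated_free_product (A : starAlgType K)
    (iota : forall j, A_ j -> A) : Prop :=
  [/\ forall j, star_hom (iota j),
      forall b, iota true (beta true b) = iota false (beta false b)
    & forall (D : nuAlgType K) (f : forall j, A_ j -> D),
        (forall j, alg_hom (f j)) ->
        (forall b, f true (beta true b) = f false (beta false b)) ->
        exists g : A -> D,
          [/\ alg_hom g,
              forall j x, g (iota j x) = f j x
            & forall h : A -> D, alg_hom h ->
                (forall j x, h (iota j x) = f j x) -> h =1 g]].

(* A word a_1 ... a_n whose letters a_i belong to A_ (eps i) is a sequence of
   dependent pairs (eps i, a_i). *)
Definition letter : Type := {j : bool & A_ j}.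

Definition alternating (w : seq letter) : bool :=
  sorted (fun l l' => tag l != tag l') w.

Definition letter_map (T : Type) (f : forall j, A_ j -> T) (l : letter) : T :=
  f (tag l) (tagged l).

Definition is_cond_free_product (Phi_ Psi_ : forall j, A_ j -> B)
    (A : starAlgType K) (iota : forall j, A_ j -> A) (Phi Psi : A -> B) : Prop :=
  [/\ is_amalgamated_free_product iota,
      cond_exp (fun b => iota true (beta true b)) Phi,
      cond_exp (fun b => iota true (beta true b)) Psi
    & forall (l : letter) (s : seq letter),
        alternating (l :: s) ->
        (forall i, (i < size (l :: s))%N ->
           letter_map Psi_ (nth l (l :: s) i) = 0) ->
        let a := word_prod (letter_map iota l) (map (letter_map iota) s) in
        Psi a = 0 /\
        Phi a = word_prod (letter_map Phi_ l) (map (letter_map Phi_) s)].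

End FreeProduct.

(* Main.v *)
Require Import Defs.
From HB Require Import structures.
From mathcomp Require Import all_boot all_order all_algebra.
From mathcomp Require Import ring lra.
From mathcomp Require Import complex.
From mathcomp Require Import boolp classical_sets reals topology normedtype.

(** Write D(w, v) = Phi(w^† v) - Phi(w)^† Phi(v) for the covariance of Phi. It
    vanishes when w or v is a scalar from B, and on two centred alternating words
    whose first letters come from different factors, because Phi is then
    multiplicative on w^† v. If the first letters x, y come from the same factor
    A_j, splitting x^† y into its centred part and its Psi_j-expectation gives
      D(x s, y t) = Phi(s)^† D_j(x, y) Phi(t) + D(s, Psi_j(x^† y) t),
    where D_j is the covariance of Phi_j (cov_words_same). So D is positive by
    induction on the length of words (upos_cov_words): the first term is a
    variance of Phi_j, positive by Kadison's inequality (upos_variance); in the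
    second, the matrix of the Psi_j(x_k^† x_l) is positive in the matrices over B,
    hence of the form C^† C (matrix_sqrt), and the sum of the D(s_k, X_kl s_l) is
    the sum over m of the D(b_m, b_m) with b_m the combination of the shorter
    words s_k with coefficients C_mk. As the words span the free product
    (word_span_all), Phi(a^† a) = D(a, a) + Phi(a)^† Phi(a) is positive.
    Positivity of Psi is the case Phi_j = Psi_j of the same argument.

    Everything takes place in the unitizations K + A, where one can speak of
    1 - x and of the empty word. A positive element of the unitization of B which
    lies in B has its square root in B, so nothing is lost.

    The facts needed about a C^*-algebra, namely that squares h^2 of self-adjoint
    elements, sums of positive elements and all c^† c are positive, and that a
    positive matrix is a square, are derived without spectral theory. Positivity
    of a self-adjoint u is read as |t - u| <= t for some t, which makes sums
    obvious. Square roots come from the iteration g := (x + g^2) / 2, which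
    converges to 1 - sqrt(1 - x) as soon as |x| <= 1 (one_minus_sqrt), in any
    Banach algebra: it is used in the unitization of B and in the matrices over
    it. Conversely, h^2 is positive because h + i sqrt(1 - h^2) is unitary for
    |h| <= 1 (upos_sqr), and c^† c is treated as in the argument of Kelley and
    Vaught, with the comparison of the spectra of d^† d and d d^† replaced by an
    estimate on powers (upos_mul_starC). *)

Set Implicit Arguments.
Unset Strict Implicit.
Unset Printing Implicit Defensive.

Import Order.TTheory GRing.Theory Num.Theory.
Import numFieldNormedType.Exports.

Local Open Scope ring_scope.

(** * Unitizations *)

Section NUAlgebraTheory.
Variables (K : pzRingType) (A : nuAlgType K).
Implicit Types x y z : A.

Lemma numul0x x : 0 ** x = 0.
Proof. by have := nuscaleAl 0 0 x; rewrite !scale0r. Qed.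

Lemma numulx0 x : x ** 0 = 0.
Proof. by have := nuscaleAr 0 x 0; rewrite !scale0r. Qed.

Lemma numulNx x y : (- x) ** y = - (x ** y).
Proof. by rewrite -scaleN1r -nuscaleAl scaleN1r. Qed.

Lemma numulxN x y : x ** (- y) = - (x ** y).
Proof. by rewrite -scaleN1r -nuscaleAr scaleN1r. Qed.

End NUAlgebraTheory.

(** The unit is adjoined even if A has one, so that A is always the kernel of
    the projection to the scalars. *)
Definition unitization (K : numClosedFieldType) (A : nuAlgType K) : Type :=
  (K^o * A)%type.

Section Unitization.
Variables (K : numClosedFieldType) (A : nuAlgType K).

HB.instance Definition _ := GRing.Lmodule.copy (unitization A) (K^o * A)%type.

Implicit Types u v w : unitization A.

Definition umul u v : unitization A :=
  (u.1 * v.1, u.1 *: v.2 + v.1 *: u.2 + u.2 ** v.2).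

Definition uone : unitization A := (1, 0).

Let pairE u v : u.1 = v.1 -> u.2 = v.2 -> u = v.
Proof. by case: u v => [? ?] [? ?] /= -> ->. Qed.

Fact umulA : associative umul.
Proof.
move=> u v w; apply: pairE => /=; first exact: mulrA.
rewrite !scalerDr !scalerA !numulDl !numulDr !numulA -!nuscaleAl -!nuscaleAr.
rewrite !addrA (mulrC w.1 u.1) (mulrC w.1 v.1).
by rewrite [LHS](ACl (1*2*4*6*3*5*7))%AC.
Qed.

Fact umul1u : left_id uone umul.
Proof.
move=> u; apply: pairE => /=; first exact: mul1r.
by rewrite scale1r scaler0 addr0 numul0x addr0.
Qed.

Fact umulu1 : right_id uone umul.
Proof.
move=> u; apply: pairE => /=; first exact: mulr1.
by rewrite scale1r scaler0 add0r numulx0 addr0.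
Qed.

Fact umulDl : left_distributive umul +%R.
Proof.
move=> u v w; apply: pairE => /=; first exact: mulrDl.
by rewrite scalerDl scalerDr numulDl [LHS](AC ((2*2)*2) ((1*3*5)*(2*4*6)))%AC.
Qed.

Fact umulDr : right_distributive umul +%R.
Proof.
move=> u v w; apply: pairE => /=; first exact: mulrDr.
by rewrite scalerDl scalerDr numulDr [LHS](AC ((2*2)*2) ((1*3*5)*(2*4*6)))%AC.
Qed.

Fact uone_neq0 : uone != 0.
Proof. by apply/eqP => /(congr1 fst)/eqP; rewrite oner_eq0. Qed.

HB.instance Definition _ := GRing.Zmodule_isNzRing.Build (unitization A)
  umulA umul1u umulu1 umulDl umulDr uone_neq0.

Fact uscaleAl (k : K) u v : k *: (u * v) = (k *: u) * v.
Proof.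
apply: pairE => /=; first exact: mulrA.
by rewrite !scalerDr !scalerA nuscaleAl (mulrC v.1 k).
Qed.

HB.instance Definition _ :=
  GRing.Lmodule_isLalgebra.Build K (unitization A) uscaleAl.

Fact uscaleAr (k : K) u v : k *: (u * v) = u * (k *: v).
Proof.
apply: pairE => /=; first by rewrite /GRing.scale /= mulrCA.
by rewrite !scalerDr !scalerA nuscaleAr (mulrC u.1 k).
Qed.

HB.instance Definition _ :=
  GRing.Lalgebra_isAlgebra.Build K (unitization A) uscaleAr.

Definition uinj (x : A) : unitization A := (0, x).

Lemma unitization_eq u v : u.1 = v.1 -> u.2 = v.2 -> u = v.
Proof. exact: pairE. Qed.

Lemma uinjM x y : uinj x * uinj y = uinj (x ** y).
Proof. by apply: pairE => /=; rewrite ?mul0r // !scale0r !add0r. Qed.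

Lemma umul_inj u x : u * uinj x = uinj (u * uinj x).2.
Proof. by apply: pairE => //=; rewrite mulr0. Qed.

Lemma uinj_mul u x : uinj x * u = uinj (uinj x * u).2.
Proof. by apply: pairE => //=; rewrite mul0r. Qed.

Lemma uinj_linear : linear uinj.
Proof. by move=> k x y; apply: pairE => //=; rewrite scaler0 addr0. Qed.

HB.instance Definition _ :=
  GRing.isLinear.Build K A (unitization A) _ uinj uinj_linear.

Lemma uinjD : {morph uinj : x y / x + y}. Proof. exact: raddfD. Qed.
Lemma uinjN : {morph uinj : x / - x}. Proof. exact: raddfN. Qed.
Lemma uinjB : {morph uinj : x y / x - y}. Proof. exact: raddfB. Qed.
Lemma uinjZ k x : uinj (k *: x) = k *: uinj x. Proof. exact: linearZ. Qed.
Lemma uinj0 : uinj 0 = 0. Proof. by []. Qed.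
Lemma uinj_inj : injective uinj. Proof. by move=> x y []. Qed.

End Unitization.

Section UnitizationStar.
Variables (K : numClosedFieldType) (A : starAlgType K).
Implicit Types u v : unitization A.

Definition ustar u : unitization A := (u.1^*, star u.2).

Lemma ustarD : {morph ustar : u v / u + v}.
Proof.
by move=> u v; apply: unitization_eq => /=; rewrite ?rmorphD ?starD.
Qed.

Lemma ustarZ k u : ustar (k *: u) = k^* *: ustar u.
Proof.
by apply: unitization_eq => /=; rewrite ?starZ // /GRing.scale /= rmorphM.
Qed.

Lemma ustarM u v : ustar (u * v) = ustar v * ustar u.
Proof.
apply: unitization_eq => /=; first by rewrite rmorphM mulrC.
by rewrite !starD !starZ starM (addrC (_ *: star v.2)).
Qed.

Lemma ustarK : involutive ustar.
Proof. by move=> u; apply: unitization_eq => /=; rewrite ?conjCK ?starK. Qed.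

Lemma ustarN u : ustar (- u) = - ustar u.
Proof. by rewrite -scaleN1r ustarZ rmorphN rmorph1 scaleN1r. Qed.

Lemma ustarB u v : ustar (u - v) = ustar u - ustar v.
Proof. by rewrite ustarD ustarN. Qed.

Lemma ustar0 : ustar 0 = 0.
Proof. by have := ustarB 0 0; rewrite !subrr. Qed.

Lemma ustar1 : ustar 1 = 1.
Proof.
by rewrite -[LHS]mulr1 -[X in _ * X]ustarK -ustarM mulr1 ustarK.
Qed.

Lemma ustar_sum (I : Type) (s : seq I) (F : I -> unitization A) :
  ustar (\sum_(i <- s) F i) = \sum_(i <- s) ustar (F i).
Proof. exact: (big_morph ustar ustarD ustar0). Qed.

Lemma ustar_inj (x : A) : ustar (uinj x) = uinj (star x).
Proof. by apply: unitization_eq => //=; rewrite rmorph0. Qed.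

End UnitizationStar.

Notation "u ^†" := (ustar u) (at level 2, format "u ^†") : ring_scope.

Section UnitizationMap.
Variables (K : numClosedFieldType).

Definition umap (A D : nuAlgType K) (f : A -> D) (u : unitization A) :
  unitization D := (u.1, f u.2).

Lemma umap_linear (A D : nuAlgType K) (f : A -> D) : linear f ->
  linear (umap f).
Proof. by move=> lf k u v; apply: unitization_eq => //=; rewrite lf. Qed.

Lemma linear_map0 (A D : lmodType K) (f : A -> D) : linear f -> f 0 = 0.
Proof. by move=> /(_ (-1) 0 0); rewrite scaler0 addr0 scaleN1r addNr. Qed.

Lemma linear_mapD (A D : lmodType K) (f : A -> D) : linear f ->
  {morph f : x y / x + y}.
Proof. by move=> lf x y; have := lf 1 x y; rewrite !scale1r. Qed.

Lemma linear_mapZ (A D : lmodType K) (f : A -> D) : linear f ->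
  forall k x, f (k *: x) = k *: f x.
Proof. by move=> lf k x; have := lf k x 0; rewrite (linear_map0 lf) !addr0. Qed.

Lemma linear_mapB (A D : lmodType K) (f : A -> D) : linear f ->
  {morph f : x y / x - y}.
Proof.
by move=> lf x y; rewrite (linear_mapD lf) -scaleN1r (linear_mapZ lf) scaleN1r.
Qed.

Lemma linear_map_sum (A D : lmodType K) (f : A -> D) : linear f ->
  forall (I : Type) (s : seq I) (F : I -> A),
    f (\sum_(i <- s) F i) = \sum_(i <- s) f (F i).
Proof.
by move=> lf I s F; apply: (big_morph f (linear_mapD lf) (linear_map0 lf)).
Qed.

Lemma umap1 (A D : nuAlgType K) (f : A -> D) : linear f -> umap f 1 = 1.
Proof. by move=> lf; apply: unitization_eq => //=; apply: linear_map0. Qed.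

Lemma umap_inj (A D : nuAlgType K) (f : A -> D) x :
  umap f (uinj x) = uinj (f x).
Proof. by []. Qed.

Lemma umapM (A D : nuAlgType K) (f : A -> D) : alg_hom f ->
  {morph umap f : u v / u * v}.
Proof.
move=> [lf mf] u v; apply: unitization_eq => //=.
by rewrite !(linear_mapD lf) !(linear_mapZ lf) mf.
Qed.

Lemma umap_star (A D : starAlgType K) (f : A -> D) :
  {morph f : x / star x} -> {morph umap f : u / u^†}.
Proof. by move=> sf u; apply: unitization_eq => //=. Qed.

End UnitizationMap.

(** * Square roots in Banach algebras *)

(** A complete submultiplicative norm, given through the relation |u| <= r rather
    than as a function: for operators and matrices that relation has a direct
    description, whereas the norm itself is a supremum. *)
Record banach_bound (R : realType) (S : pzRingType) (bd : S -> R -> Prop) := {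
  bd_ge0 : forall u r, bd u r -> 0 <= r;
  bd_le : forall u r s, bd u r -> r <= s -> bd u s;
  bd_zero : bd 0 0;
  bdD : forall u v r s, bd u r -> bd v s -> bd (u + v) (r + s);
  bdN : forall u r, bd u r -> bd (- u) r;
  bdM : forall u v r s, bd u r -> bd v s -> bd (u * v) (r * s);
  bd_ex : forall u, exists r, bd u r;
  bd_eq0 : forall u, (forall e, 0 < e -> bd u e) -> u = 0;
  bd_complete : forall u : nat -> S,
    (forall e, 0 < e -> exists N, forall m n, (N <= n <= m)%N ->
       bd (u m - u n) e) ->
    exists l, forall e, 0 < e -> exists N, forall n, (N <= n)%N ->
       bd (l - u n) e
}.

Section SquareRoot.
Variables (R : realType) (S : pzRingType) (bd : S -> R -> Prop).
Hypothesis bdS : banach_bound bd.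
Variables half x : S.
Hypotheses (halfE : half + half = 1) (bd_half : bd half 2^-1) (bdx : bd x 1).

(** A fixed point l of y := (x + y^2) / 2 has (1 - l)^2 = 1 - x. *)
Fixpoint visser n : S :=
  if n is n'.+1 then half * (x + visser n' * visser n') else 0.

(** The same iteration for x = 1; it increases to 1. Since the iterates are
    polynomials in x with nonnegative coefficients, their increments are bounded
    by the increments of this sequence. *)
Fixpoint visser_bound n : R :=
  if n is n'.+1 then 2^-1 * (1 + visser_bound n' ^+ 2) else 0.

Let g := visser.
Let q := visser_bound.

Let gS n : g n.+1 = half * (x + g n * g n). Proof. by []. Qed.
Let qS n : q n.+1 = 2^-1 * (1 + q n ^+ 2). Proof. by []. Qed.

Let q_ge0_le1 n : 0 <= q n <= 1.
Proof. by rewrite /q; elim: n => [|n /andP[? ?]] /=; [lra | nra]. Qed.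

(** The distance e to the limit obeys e := e - e^2 / 2, and 2 / (n + 2) decreases
    more slowly. *)
Lemma visser_bound_rate n : 1 - q n <= 2 / n.+2%:R.
Proof.
elim: n => [|n IHn]; first by rewrite /q /=; lra.
have /andP[q0 q1] := q_ge0_le1 n.
rewrite ler_pdivlMr ?ltr0n // in IHn; rewrite ler_pdivlMr ?ltr0n //.
rewrite qS.
rewrite [n.+3%:R]mulrSr; move: IHn; rewrite !(mulrSr _ n.+1) (mulrSr _ n).
have := ler0n R n; move: (n%:R) (q n) q0 q1 => a b *; nra.
Qed.

Let bd_visser n : bd (g n) (q n).
Proof.
elim: n => [|n IHn] /=; first exact: bd_zero bdS.
apply: (bdM bdS bd_half); rewrite expr2.
exact: (bdD bdS bdx (bdM bdS IHn IHn)).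
Qed.

Let bd_visserS n : bd (g n.+1 - g n) (q n.+1 - q n).
Proof.
elim: n => [|n IHn].
  by have := bd_visser 1; rewrite !subr0.
have -> : g n.+2 - g n.+1 =
    half * ((g n.+1 - g n) * g n.+1 + g n * (g n.+1 - g n)).
  rewrite mulrBl mulrBr addrA subrK.
  by rewrite (gS n.+1) [X in _ - X = _]gS -mulrBr opprD addrACA subrr add0r.
have -> : q n.+2 - q n.+1 =
    2^-1 * ((q n.+1 - q n) * q n.+1 + q n * (q n.+1 - q n)).
  by rewrite (qS n.+1) [X in _ - X = _]qS; ring.
apply: (bdM bdS bd_half); apply: (bdD bdS).
  exact: (bdM bdS IHn (bd_visser _)).
exact: (bdM bdS (bd_visser _) IHn).
Qed.

Let bd_visser_diff n k : bd (g (k + n)%N - g n) (q (k + n)%N - q n).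
Proof.
elim: k => [|k IHk]; first by rewrite !subrr; exact: bd_zero bdS.
have := bdD bdS (bd_visserS (k + n)) IHk; rewrite -!addSn.
by rewrite !addrA !subrK.
Qed.

Let visser_cvg : exists l, forall e, 0 < e -> exists N, forall n, (N <= n)%N ->
  bd (l - g n) e.
Proof.
apply: (bd_complete bdS) => e e0.
exists (Num.bound (2 / e)) => m n /andP[Nn nm].
rewrite -(subnK nm); apply: (bd_le bdS (bd_visser_diff n _)).
have /andP[_ q1] := q_ge0_le1 (m - n + n)%N.
apply: (@le_trans _ _ (1 - q n)); first by lra.
apply: (le_trans (visser_bound_rate n)).
rewrite ler_pdivrMr ?ltr0n // mulrC -ler_pdivrMr //.
apply/ltW/(lt_le_trans (archi_boundP _)); first by rewrite divr_ge0 // ltW.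
by rewrite ler_nat; apply: (leq_trans Nn); rewrite -addn2 leq_addr.
Qed.

Theorem one_minus_sqrt : exists l : S,
  [/\ (1 - l) * (1 - l) = 1 - x,
      forall y, y * x = x * y -> y * l = l * y,
      forall e, 0 < e -> bd l (1 + e)
    & forall st : S -> S,
        {morph st : u v / u + v} -> (forall u v, st (u * v) = st v * st u) ->
        (forall u r, bd u r -> bd (st u) r) -> st half = half ->
        st x = x -> st l = l].
Proof.
have [l lim_l] := visser_cvg.
have halfC y : half * y = y * half.
  have half2 z : half * z + half * z = z by rewrite -mulrDl halfE mul1r.
  have half2' z : z * half + z * half = z by rewrite -mulrDr halfE mulr1.
  rewrite -[in LHS](half2' y) mulrDr !mulrA -mulrDl.
  by rewrite half2.
exists l; split.
- have [M bdM_l] := bd_ex bdS l; have M0 := bd_ge0 bdS bdM_l.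
  suff El : l = half * (x + l * l).
    have <- : l + l - l * l = x.
      by rewrite {1 2}El -mulrDl halfE mul1r addrK.
    by rewrite mulrBl mul1r mulrBr mulr1 !opprD !opprK !addrA.
  apply/eqP; rewrite -subr_eq0; apply/eqP; apply: (bd_eq0 bdS) => e e0.
  have d0 : 0 < e / (2 + M) by apply: divr_gt0 => //; lra.
  have [N lN] := lim_l _ d0.
  have -> : l - half * (x + l * l) =
      (l - g N.+1) + half * ((l - g N) * - g N + l * - (l - g N)).
    have -> : (l - g N) * - g N + l * - (l - g N) = g N * g N - l * l.
      by rewrite !mulrN mulrBl mulrBr !opprB addrA subrK.
    rewrite gS -[RHS]addrA -!(mulrN half) -mulrDr.
    by congr (_ + half * _); rewrite !opprD addrA subrK.
  apply: (bd_le bdS).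
    apply: (bdD bdS (lN N.+1 (leqnSn _))); apply: (bdM bdS bd_half).
    apply: (bdD bdS).
      exact: (bdM bdS (lN N (leqnn _)) (bdN bdS (bd_visser N))).
    exact: (bdM bdS bdM_l (bdN bdS (lN N (leqnn _)))).
  have /andP[_ q1] := q_ge0_le1 N.
  have eE : (e / (2 + M)) * (2 + M) = e by rewrite divfK // gt_eqF //; lra.
  rewrite -[leRHS]eE; move: (e / _) d0 (q N) q1 {eE lN} => d d0 r r1.
  have := mulr_ge0 (ltW d0) M0; have := mulr_ge0 (ltW d0) (_ : 0 <= 1 - r).
  by rewrite subr_ge0 => /(_ r1) H1 H2; lra.
- move=> y yx.
  have yg n : y * g n = g n * y.
    elim: n => [|n IHn]; first by rewrite mulr0 mul0r.
    rewrite gS mulrA -halfC -!mulrA mulrDr mulrDl yx.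
    by rewrite mulrA IHn -!mulrA IHn.
  have [M bdy] := bd_ex bdS y; have M0 := bd_ge0 bdS bdy.
  apply/eqP; rewrite -subr_eq0; apply/eqP; apply: (bd_eq0 bdS) => e e0.
  have d0 : 0 < e / (1 + M + M) by apply: divr_gt0 => //; lra.
  have [N lN] := lim_l _ d0; have {}lN := lN N (leqnn _).
  have -> : y * l - l * y = y * (l - g N) + - ((l - g N) * y).
    by rewrite mulrBr mulrBl opprB addrA yg subrK.
  apply: (bd_le bdS).
    exact: (bdD bdS (bdM bdS bdy lN) (bdN bdS (bdM bdS lN bdy))).
  rewrite mulrC -mulrDr mulrAC ler_pdivrMr; [nra | lra].
- move=> e e0; have [N lN] := lim_l _ e0; have {}lN := lN N (leqnn _).
  rewrite -[l](subrK (g N)) addrC.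
  apply: (bd_le bdS (bdD bdS (bd_visser N) lN)).
  by have /andP[_ q1] := q_ge0_le1 N; rewrite lerD2r.
- move=> st stD stM bd_st st_half st_x.
  have st0 : st 0 = 0 by apply: (addrI (st 0)); rewrite -stD !addr0.
  have stB u v : st (u - v) = st u - st v.
    by apply: (addIr (st v)); rewrite -stD !subrK.
  have st_g n : st (g n) = g n.
    elim: n => [|n IHn]; first exact: st0.
    by rewrite gS stM stD stM st_x IHn st_half halfC.
  apply/eqP; rewrite -subr_eq0; apply/eqP; apply: (bd_eq0 bdS) => e e0.
  have [N lN] := lim_l _ (divr_gt0 e0 (ltr0n R 2)).
  have {}lN := lN N (leqnn _).
  have -> : st l - l = st (l - g N) + - (l - g N).
    by rewrite stB st_g opprB addrA subrK.
  by rewrite (splitr e); apply: (bdD bdS (bd_st _ _ lN) (bdN bdS lN)).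
Qed.

End SquareRoot.

(** * Real-valued norms over the complex numbers *)

Lemma cauchy_seq_cvg (K : numFieldType) (V : completeNormedModType K)
    (u : nat -> V) :
  (forall e : K, 0 < e -> exists N, forall m n, (N <= n <= m)%N ->
     `|u m - u n| < e) ->
  exists l, forall e : K, 0 < e -> exists N, forall n, (N <= n)%N ->
    `|l - u n| < e.
Proof.
move=> u_cauchy.
have /cvg_ex[l u_l] : cvg (u @ \oo)%classic.
  apply: cauchy_cvg; apply: cauchy_exP => e /u_cauchy[N uN].
  exists (u N); exists N => // n /= Nn; rewrite -ball_normE /ball_ /=.
  by rewrite distrC; apply: uN; rewrite leqnn.
exists l => e e0; have /cvgrPdist_lt/(_ _ e0)[N _ lN] := u_l.
by exists N.
Qed.

Section RealNorm.
Variables (R : realType).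
Local Notation K := R[i].

(** Norms over R[i] take values in R[i], which is only partially ordered. *)
Definition rnorm (V : normedZmodType K) (v : V) : R := complex.Re `|v|.

Lemma rnormE (V : normedZmodType K) (v : V) : (rnorm v)%:C%C = `|v|.
Proof. exact: RRe_real (normr_real _). Qed.

Lemma ler_real_complex (x y : R) : (x%:C%C <= y%:C%C) = (x <= y).
Proof. by rewrite lecR. Qed.

Lemma ltr_real_complex (x y : R) : (x%:C%C < y%:C%C) = (x < y).
Proof. by rewrite ltcR. Qed.

Lemma rnorm_ge0 (V : normedZmodType K) (v : V) : 0 <= rnorm v.
Proof. by rewrite -ler_real_complex rnormE rmorph0. Qed.

Lemma rnorm0 (V : normedZmodType K) : rnorm (0 : V) = 0.
Proof. by rewrite /rnorm normr0. Qed.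

Lemma rnorm_eq0 (V : normedZmodType K) (v : V) : rnorm v <= 0 -> v = 0.
Proof. by rewrite -ler_real_complex rnormE rmorph0 normr_le0 => /eqP. Qed.

Lemma rnormD (V : normedZmodType K) (v w : V) :
  rnorm (v + w) <= rnorm v + rnorm w.
Proof. by rewrite -ler_real_complex rmorphD /= !rnormE ler_normD. Qed.

Lemma rnormN (V : normedZmodType K) (v : V) : rnorm (- v) = rnorm v.
Proof. by rewrite /rnorm normrN. Qed.

Lemma rnormZ (V : normedModType K) (k : K) (v : V) :
  rnorm (k *: v) = rnorm k * rnorm v.
Proof. by apply: (@complexI R); rewrite rmorphM /= !rnormE normrZ. Qed.

Lemma rnormM (k l : K) : rnorm (k * l) = rnorm k * rnorm l.
Proof. by apply: (@complexI R); rewrite rmorphM /= !rnormE normrM. Qed.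

Lemma rnorm_conj (k : K) : rnorm k^* = rnorm k.
Proof. by apply: (@complexI R); rewrite !rnormE norm_conjC. Qed.

Lemma rnorm_real (x : R) : rnorm (x%:C%C : K) = `|x|.
Proof. by rewrite /rnorm normc_def /= expr0n addr0 sqrtr_sqr. Qed.

Lemma cauchy_seq_rnorm (V : completeNormedModType K) (u : nat -> V) :
  (forall e : R, 0 < e -> exists N, forall m n, (N <= n <= m)%N ->
     rnorm (u m - u n) <= e) ->
  exists l, forall e : R, 0 < e -> exists N, forall n, (N <= n)%N ->
    rnorm (l - u n) <= e.
Proof.
move=> u_cauchy; have [|l u_l] := @cauchy_seq_cvg _ V u.
  move=> e e0; have eE := RRe_real (gtr0_real e0).
  have e'0 : 0 < complex.Re e by rewrite -ltr_real_complex eE.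
  have [N uN] := u_cauchy _ (divr_gt0 e'0 (ltr0n R 2)).
  exists N => m n /uN; rewrite -rnormE -eE ltr_real_complex => h.
  by apply: (le_lt_trans h); rewrite ltr_pdivrMr ?ltr0n // ltr_pMr // ltr1n.
exists l => e; rewrite -ltr_real_complex => /u_l[N lN]; exists N => n /lN.
by rewrite -rnormE ltr_real_complex => /ltW.
Qed.

Lemma cauchy_seq_complex (u : nat -> K) :
  (forall e : R, 0 < e -> exists N, forall m n, (N <= n <= m)%N ->
     rnorm (u m - u n) <= e) ->
  exists l, forall e : R, 0 < e -> exists N, forall n, (N <= n)%N ->
    rnorm (l - u n) <= e.
Proof.
have Re_le (z : K) : `|complex.Re z| <= rnorm z.
  by rewrite -ler_real_complex rnormE normc_ge_Re.
have Im_le (z : K) : `|complex.Im z| <= rnorm z.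
  rewrite /rnorm normc_def /= -sqrtr_sqr ler_wsqrtr //.
  by rewrite lerDr sqr_ge0.
have le_ReIm (z : K) : rnorm z <= `|complex.Re z| + `|complex.Im z|.
  rewrite -ler_real_complex rmorphD /= rnormE {1}[z]complexE.
  apply: (le_trans (ler_normD _ _)); rewrite normrM.
  rewrite [`|'i|]normc_def /= expr0n expr1n add0r sqrtr1 mul1r.
  by rewrite -!rnormE !rnorm_real.
have cvgR (f : K -> R) : {morph f : x y / x - y} ->
    (forall z, `|f z| <= rnorm z) -> forall v,
    (forall e : R, 0 < e -> exists N, forall m n, (N <= n <= m)%N ->
     rnorm (v m - v n) <= e) -> exists l, forall e : R, 0 < e ->
       exists N, forall n, (N <= n)%N -> `|l - f (v n)| < e.
  move=> fB f_le v v_cauchy.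
  apply: (@cauchy_seq_cvg R R (f \o v)) => e e0.
  have [N vN] := v_cauchy _ (divr_gt0 e0 (ltr0n R 2)).
  exists N => m n /vN h; rewrite /= -fB; apply: (le_lt_trans (f_le _)).
  by apply: (le_lt_trans h); rewrite ltr_pdivrMr ?ltr0n // ltr_pMr // ltr1n.
move=> u_cauchy.
have [a ua] := cvgR _ (raddfB (@complex.Re R)) Re_le _ u_cauchy.
have [b ub] := cvgR _ (raddfB (@complex.Im R)) Im_le _ u_cauchy.
exists (Complex a b) => e e0; have e20 := divr_gt0 e0 (ltr0n R 2).
have [N aN] := ua _ e20; have [M bM] := ub _ e20.
exists (maxn N M) => n; rewrite geq_max => /andP[Nn Mn].
apply: (le_trans (le_ReIm _)); rewrite (splitr e).
by rewrite !raddfB; apply: lerD; apply: ltW; [apply: aN | apply: bM].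
Qed.

End RealNorm.

(** * The norm on the unitization of a C^*-algebra *)

Section CStarNorm.
Variables (R : realType) (B : cstarAlgType R[i]).
Local Notation K := R[i].
Implicit Types (z : B) (u v : unitization B) (r : R).

Lemma rnorm_numul (x y : B) : rnorm (x ** y) <= rnorm x * rnorm y.
Proof. by rewrite -ler_real_complex rmorphM /= !rnormE norm_numul. Qed.

Lemma rnorm_star_mul (x : B) : rnorm (star x ** x) = rnorm x ^+ 2.
Proof. by apply: (@complexI R); rewrite rmorphXn /= !rnormE norm_star_mul. Qed.

Lemma rnorm_star (x : B) : rnorm (star x) = rnorm x.
Proof.
have le_star (y : B) : rnorm y <= rnorm (star y).
  have [->|y0] := eqVneq (rnorm y) 0; first exact: rnorm_ge0.
  have {}y0 : 0 < rnorm y by rewrite lt_def y0 rnorm_ge0.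
  by rewrite -(ler_pM2r y0) -expr2 -rnorm_star_mul rnorm_numul.
by apply/le_anti; rewrite le_star -{2}[x]starK le_star.
Qed.

(** The unitization acts on B as the ideal that it contains. *)
Definition uact u z : B := u.1 *: z + u.2 ** z.

(** The larger of the operator norm on B and of the modulus of the scalar part.
    If B has a unit, the action on B alone is not faithful. *)
Definition normle u r :=
  rnorm (u.1 : K) <= r /\ forall z, rnorm (uact u z) <= r * rnorm z.

Lemma uinj_act u z : uinj (uact u z) = u * uinj z.
Proof.
by apply: unitization_eq => /=; rewrite ?mulr0 // scale0r addr0.
Qed.

Lemma uactM u v z : uact (u * v) z = uact u (uact v z).
Proof. by apply: uinj_inj; rewrite !uinj_act mulrA. Qed.

Lemma uactD u v z : uact (u + v) z = uact u z + uact v z.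
Proof. by apply: uinj_inj; rewrite [RHS]uinjD !uinj_act mulrDl. Qed.

Lemma uactN u z : uact (- u) z = - uact u z.
Proof. by apply: uinj_inj; rewrite uinjN !uinj_act mulNr. Qed.

Lemma uact_scale (k : K) z : uact (k *: 1) z = k *: z.
Proof. by apply: uinj_inj; rewrite uinj_act -scalerAl mul1r -uinjZ. Qed.

Lemma uact_star u z :
  star (uact u z) ** uact u z = star z ** uact (u^† * u) z.
Proof.
apply: uinj_inj; rewrite -!uinjM -ustar_inj !uinj_act ustarM ustar_inj.
by rewrite !mulrA.
Qed.

Lemma normle_le u r s : normle u r -> r <= s -> normle u s.
Proof.
move=> [u1 u2] rs; split; first exact: le_trans rs.
by move=> z; apply: (le_trans (u2 z)); rewrite ler_wpM2r ?rnorm_ge0.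
Qed.

Lemma normle_ge0 u r : normle u r -> 0 <= r.
Proof. by move=> [u1 _]; apply: le_trans u1; apply: rnorm_ge0. Qed.

Lemma normleD u v r s : normle u r -> normle v s -> normle (u + v) (r + s).
Proof.
move=> [u1 u2] [v1 v2]; split.
  by apply: (le_trans (rnormD _ _)); exact: lerD.
move=> z; rewrite uactD mulrDl; apply: (le_trans (rnormD _ _)); exact: lerD.
Qed.

Lemma normleN u r : normle u r -> normle (- u) r.
Proof. by move=> [u1 u2]; split=> [|z]; rewrite ?uactN rnormN. Qed.

Lemma normleM u v r s : normle u r -> normle v s -> normle (u * v) (r * s).
Proof.
move=> bu [v1 v2]; have r0 := normle_ge0 bu; case: bu => u1 u2; split.
  by rewrite rnormM ler_pM ?rnorm_ge0.
move=> z; rewrite uactM; apply: (le_trans (u2 _)).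
by rewrite -mulrA ler_wpM2l.
Qed.

Lemma normle_scale (k : K) : normle (k *: 1) (rnorm k).
Proof.
split; first by rewrite /= /GRing.scale /= mulr1.
by move=> z; rewrite uact_scale rnormZ.
Qed.

Lemma normleZ (k : K) u r : normle u r -> normle (k *: u) (rnorm k * r).
Proof.
move=> bu; rewrite -[u]mul1r scalerAl; apply: normleM bu.
exact: normle_scale.
Qed.

Lemma normle_ex u : exists r, normle u r.
Proof.
exists (rnorm (u.1 : K) + rnorm u.2); split; first by rewrite lerDl rnorm_ge0.
move=> z; apply: (le_trans (rnormD _ _)); rewrite mulrDl rnormZ lerD //.
exact: rnorm_numul.
Qed.

Lemma normle_limit u r : (forall e, 0 < e -> normle u (r + e)) -> normle u r.
Proof.
move=> ur; split.
  by apply/ler_addgt0Pr => e /ur[].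
move=> z; have [z0|z0] := leP (rnorm z) 0.
  have -> : z = 0 by exact: rnorm_eq0.
  by rewrite /uact scaler0 numulx0 addr0 rnorm0 mulr0.
rewrite -ler_pdivrMr //; apply/ler_addgt0Pr => e /ur[_ /(_ z)].
by rewrite ler_pdivrMr.
Qed.

(** Multiplication by b takes the adjoint of b, of norm |b|, to an element of
    norm |b|^2. *)
Lemma rnorm_lmul_le (b : B) r : 0 <= r ->
  (forall z, rnorm (b ** z) <= r * rnorm z) -> rnorm b <= r.
Proof.
move=> r0 /(_ (star b)); rewrite -{1}[b]starK rnorm_star_mul rnorm_star.
have [->//|b0] := eqVneq (rnorm b) 0.
have {}b0 : 0 < rnorm b by rewrite lt_def b0 rnorm_ge0.
by rewrite expr2 ler_pM2r.
Qed.

Lemma normle_components u r :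
  normle u r -> rnorm (u.1 : K) <= r /\ rnorm u.2 <= r + r.
Proof.
move=> [u1 u2]; split=> //; have r0 := le_trans (rnorm_ge0 _) u1.
apply: rnorm_lmul_le => [|z]; first exact: addr_ge0.
have -> : u.2 ** z = uact u z - u.1 *: z by rewrite addrAC subrr add0r.
apply: (le_trans (rnormD _ _)); rewrite rnormN rnormZ mulrDl lerD //.
by rewrite ler_wpM2r ?rnorm_ge0.
Qed.

Lemma normle_eq0 u : normle u 0 -> u = 0.
Proof.
move=> /normle_components[]; rewrite addr0.
by move=> /rnorm_eq0 u1 /rnorm_eq0 u2; apply: unitization_eq.
Qed.

(** On B this is |u z|^2 = |z^† u^† u z| <= |z| |u^† u z|. *)
Lemma normle_cstar u r : 0 <= r -> normle (u^† * u) (r ^+ 2) -> normle u r.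
Proof.
move=> r0 [u1 u2]; split.
  move: u1; rewrite /= rnormM rnorm_conj -expr2 ler_sqr ?nnegrE ?rnorm_ge0 //.
move=> z; rewrite -ler_sqr ?nnegrE ?mulr_ge0 ?rnorm_ge0 //.
rewrite -rnorm_star_mul uact_star; apply: (le_trans (rnorm_numul _ _)).
rewrite rnorm_star exprMn [X in _ <= _ * X]expr2 mulrCA ler_wpM2l ?rnorm_ge0 //.
Qed.

Lemma normle_star u r : normle u r -> normle u^† r.
Proof.
move=> bu; have r0 := normle_ge0 bu; case: bu => u1 u2; split.
  by rewrite /= rnorm_conj.
move=> z; have [->|z0] := eqVneq (rnorm (uact u^† z)) 0.
  by rewrite mulr_ge0 ?rnorm_ge0.
have {}z0 : 0 < rnorm (uact u^† z) by rewrite lt_def z0 rnorm_ge0.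
rewrite -(ler_pM2r z0) -expr2 -rnorm_star_mul uact_star ustarK uactM.
apply: (le_trans (rnorm_numul _ _)); rewrite rnorm_star mulrAC mulrC.
by rewrite ler_wpM2r ?rnorm_ge0.
Qed.

Lemma normle_complete (u : nat -> unitization B) :
  (forall e, 0 < e -> exists N, forall m n, (N <= n <= m)%N ->
     normle (u m - u n) e) ->
  exists l, forall e, 0 < e -> exists N, forall n, (N <= n)%N ->
     normle (l - u n) e.
Proof.
move=> u_cauchy.
have [|l1 u1] := @cauchy_seq_complex R (fun n => (u n).1).
  move=> e /u_cauchy[N uN]; exists N => m n /uN[]; exact.
have [|l2 u2] := @cauchy_seq_rnorm R B (fun n => (u n).2).
  move=> e e0; have [N uN] := u_cauchy _ (divr_gt0 e0 (ltr0n R 2)).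
  exists N => m n /uN/normle_components[_]; by rewrite -splitr.
exists (l1, l2) => e e0; have e20 := divr_gt0 e0 (ltr0n R 2).
have [N Nl] := u1 _ e20; have [M Ml] := u2 _ e20.
exists (maxn N M) => n; rewrite geq_max => /andP[/Nl h1 /Ml h2]; split => /=.
  by apply: (le_trans h1); rewrite ler_pdivrMr ?ltr0n // ler_pMr // ler1n.
move=> z; apply: (le_trans (rnormD _ _)).
rewrite rnormZ (splitr e) mulrDl lerD //.
  by rewrite ler_wpM2r ?rnorm_ge0.
by apply: (le_trans (rnorm_numul _ _)); rewrite ler_wpM2r ?rnorm_ge0.
Qed.

Lemma normle_banach : banach_bound normle.
Proof.
split.
- exact: normle_ge0.
- exact: normle_le.
- have := normle_scale 0; rewrite scale0r /rnorm normr0; exact.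
- exact: normleD.
- exact: normleN.
- exact: normleM.
- exact: normle_ex.
- move=> u u0; apply: normle_eq0; apply: normle_limit => e e0.
  by rewrite add0r; apply: u0.
- exact: normle_complete.
Qed.

End CStarNorm.

(** * Positive elements of a C^*-algebra *)

Lemma mulrZZ (K : comNzRingType) (A : algType K) (k l : K) (x y : A) :
  (k *: x) * (l *: y) = (k * l) *: (x * y).
Proof. by rewrite -scalerAl -scalerAr scalerA. Qed.

Lemma polarization_mul (A : pzRingType) (x y : A) :
  (x + y) * (x + y) - (x - y) * (x - y) = (x * y + y * x) *+ 2.
Proof.
rewrite !mulrBl !mulrDl !mulrBr !mulrDr !opprB mulr2n.
rewrite [LHS](AC ((2*2)*(2*2)) (((1*8)*(4*6))*((2*3)*(7*5))))%AC.
by rewrite /= !subrr addr0 add0r.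
Qed.

(** Bernoulli's inequality, squared, makes (1 + e)^n grow quadratically in n. *)
Lemma exp2_dominates_linear (R : realType) (c e : R) : 0 < e ->
  exists k, 1 + c * (2 ^ k)%:R <= (1 + e) ^+ (2 ^ k).
Proof.
move=> e0; have bernoulli n : 1 + n%:R * e <= (1 + e) ^+ n.
  elim: n => [|n IHn]; first by rewrite mul0r addr0 expr0.
  rewrite exprS mulrSr; have := ler0n R n; move: (n%:R) IHn => m IHn m0.
  by apply: le_trans (ler_wpM2l _ IHn); nra.
pose m := (2 ^ Num.bound (2 * `|c| / e ^+ 2))%N.
have mP : 2 * `|c| <= m%:R * e ^+ 2.
  rewrite -ler_pdivrMr ?exprn_gt0 //.
  apply/ltW/(lt_le_trans (archi_boundP _)).
    by apply: divr_ge0; [exact: mulr_ge0 | exact: sqr_ge0].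
  by rewrite ler_nat ltnW // ltn_expl.
exists (Num.bound (2 * `|c| / e ^+ 2)).+1.
rewrite expnS -/m mulnC exprM natrM.
have m0 := ler0n R m; move: (bernoulli m) mP m0; move: (m%:R) => x xe cx x0.
have c_abs := ler_norm c.
have : (1 + x * e) ^+ 2 <= ((1 + e) ^+ m) ^+ 2.
  by rewrite lerXn2r ?nnegrE ?exprn_ge0 //; nra.
apply: le_trans.
have : 0 <= x * (x * e ^+ 2 - 2 * c) by apply: mulr_ge0 => //; nra.
have : 0 <= x * e by apply: mulr_ge0 => //; lra.
nra.
Qed.

Section CStarPositivity.
Variables (R : realType) (B : cstarAlgType R[i]).
Local Notation K := R[i].
Local Notation U := (unitization B).
Implicit Types (u v : U) (r t : R).
Local Notation "r %:U" := ((r%:C%C : R[i]) *: (1 : U))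
  (at level 2, format "r %:U").

Lemma normle_real r : 0 <= r -> normle r%:U r.
Proof.
by move=> r0; rewrite -{2}[r]ger0_norm // -rnorm_real; exact: normle_scale.
Qed.

Lemma normle1 : normle (1 : U) 1.
Proof. by have := normle_real ler01; rewrite rmorph1 scale1r. Qed.

Lemma normleZr r u t : 0 <= r -> normle u t -> normle (r%:C%C *: u) (r * t).
Proof. by move=> r0 /(normleZ r%:C%C); rewrite rnorm_real ger0_norm. Qed.

Lemma ustar_real r u : (r%:C%C *: u)^† = r%:C%C *: u^†.
Proof.
rewrite ustarZ; congr (_ *: _); apply: conj_Creal.
by apply/complex_realP; exists r.
Qed.

Lemma normleB u v r s : normle u r -> normle v s -> normle (u - v) (r + s).
Proof. by move=> bu bv; apply: normleD => //; apply: normleN. Qed.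

Lemma normle_sqr_eq0 u : u^† = u -> u * u = 0 -> u = 0.
Proof.
move=> us uu; apply: normle_eq0; apply: normle_cstar => //.
by rewrite us uu expr0n; exact: bd_zero (normle_banach B).
Qed.

Lemma half_add_half : (2^-1)%:U + (2^-1)%:U = 1 :> U.
Proof.
rewrite -scalerDl -rmorphD /=; have -> : (2^-1 + 2^-1 = 1 :> R) by lra.
by rewrite rmorph1 scale1r.
Qed.

Lemma usqrt_one_minus u : u^† = u -> normle u 1 -> exists l : U,
  [/\ l^† = l, (1 - l) * (1 - l) = 1 - u, normle l 1
    & forall v, v * u = u * v -> v * l = l * v].
Proof.
move=> us bu.
have bhalf : normle (2^-1)%:U 2^-1 by apply: normle_real; rewrite invr_ge0.
have [l [l2 lC bl lstar]] :=
  one_minus_sqrt (normle_banach B) half_add_half bhalf bu.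
exists l; split => //; last exact: normle_limit.
apply: lstar => //; [exact: ustarD|exact: ustarM|exact: normle_star|].
by rewrite ustar_real ustar1.
Qed.

Lemma ustar_cartesian a b : a^† = a -> b^† = b -> a * b = b * a ->
  (a + 'i *: b)^† * (a + 'i *: b) = a * a + b * b :> U.
Proof.
move=> sa sb ab; rewrite ustarD ustarZ sa sb conjCi.
rewrite mulrDl !mulrDr mulrZZ mulNr -['i * 'i]expr2 sqrCi opprK scale1r.
by rewrite -scalerAl -scalerAr ab scaleNr addrA addrK.
Qed.

(** a is the real part of a + i b, an element of norm r. *)
Lemma normle_cartesian a b r :
  0 <= r -> a^† = a -> b^† = b -> a * b = b * a ->
  a * a + b * b = (r ^+ 2)%:U -> normle a r.
Proof.
move=> r0 sa sb ab abr; set w := a + 'i *: b.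
have bw : normle w r.
  apply: normle_cstar => //; rewrite ustar_cartesian // abr.
  by apply: normle_real; exact: sqr_ge0.
have -> : a = (2^-1)%:C%C *: (w + w^†).
  rewrite /w ustarD ustarZ sa sb conjCi scaleNr addrACA subrr addr0.
  by rewrite -[a in RHS]mul1r -mulrDl scalerAl scalerDr half_add_half mul1r.
have -> : r = 2^-1 * (r + r) by lra.
apply: normleZr; first by rewrite invr_ge0.
by apply: normleD => //; exact: normle_star.
Qed.

(** If u has real spectrum, |t - u| <= t for some t means that the spectrum is
    nonnegative. In this form positivity is visibly stable under sums. *)
Definition upos u := u^† = u /\ exists t, normle (t%:U - u) t.

Lemma upos_gt0 u : upos u -> exists2 t, 0 < t & normle (t%:U - u) t.
Proof.
move=> [_ [t bt]]; have t0 := normle_ge0 bt.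
exists (t + 1); first by lra.
have -> : (t + 1)%:U - u = (t%:U - u) + 1.
  by rewrite rmorphD rmorph1 scalerDl scale1r addrAC.
by apply: normleD => //; exact: normle1.
Qed.

Lemma upos0 : upos 0.
Proof.
split; first exact: ustar0.
by exists 0; rewrite subr0; apply: normle_real.
Qed.

Lemma uposD u v : upos u -> upos v -> upos (u + v).
Proof.
move=> [su [s bs]] [sv [t bt]]; split; first by rewrite ustarD su sv.
exists (s + t); rewrite rmorphD scalerDl opprD addrACA; exact: normleD.
Qed.

Lemma upos_sum (I : Type) (s : seq I) (F : I -> U) :
  (forall i, upos (F i)) -> upos (\sum_(i <- s) F i).
Proof.
by move=> F0; elim/big_rec: _ => [|i u _]; [exact: upos0 | exact: uposD].
Qed.

Lemma uposZ r u : 0 <= r -> upos u -> upos (r%:C%C *: u).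
Proof.
move=> r0 [su [t bt]]; split; first by rewrite ustar_real su.
exists (r * t); rewrite rmorphM -scalerA -scalerBr; exact: normleZr.
Qed.

Lemma uposZ_inv r u : 0 < r -> upos (r%:C%C *: u) -> upos u.
Proof.
move=> r0 /(uposZ (_ : 0 <= r^-1)); rewrite invr_ge0 ltW // => /(_ isT).
by rewrite scalerA -rmorphM mulVf ?gt_eqF // rmorph1 scale1r.
Qed.

(** For |t - u| <= t, the root is sqrt(t) sqrt(1 - x) with x = 1 - u / t. *)
Lemma upos_sqrt u : upos u -> exists h,
  [/\ upos h, h * h = u & forall v, v * u = u * v -> v * h = h * v].
Proof.
move=> pu; have [su _] := pu; have [t t0 bt] := upos_gt0 pu.
pose x := 1 - (t^-1)%:C%C *: u.
have tinv0 : 0 <= t^-1 by rewrite invr_ge0 ltW.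
have bx : normle x 1.
  have -> : x = (t^-1)%:C%C *: (t%:U - u).
    by rewrite scalerBr scalerA -rmorphM mulVf ?gt_eqF // rmorph1 scale1r.
  by rewrite -(mulVf (lt0r_neq0 t0)); exact: normleZr.
have sx : x^† = x by rewrite ustarB ustar1 ustar_real su.
have [l [sl l2 bl lC]] := usqrt_one_minus sx bx.
exists ((Num.sqrt t)%:C%C *: (1 - l)); split.
- apply: uposZ; first exact: sqrtr_ge0.
  split; first by rewrite ustarB ustar1 sl.
  by exists 1; rewrite rmorph1 scale1r opprB addrC subrK.
- rewrite mulrZZ l2 -rmorphM -expr2 sqr_sqrtr ?ltW // /x opprB addrC subrK.
  by rewrite scalerA -rmorphM mulfV ?gt_eqF // rmorph1 scale1r.
- move=> v vu; rewrite -scalerAl -scalerAr mulrBr mulrBl mulr1 mul1r lC //.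
  by rewrite /x mulrBr mulrBl mulr1 mul1r -scalerAl -scalerAr vu.
Qed.

(** If |h| <= 1 then h + i sqrt(1 - h^2) is unitary, so that |1 - h^2| <= 1. *)
Lemma upos_sqr h : h^† = h -> upos (h * h).
Proof.
move=> sh; have [r' br'] := normle_ex h; have r'0 := normle_ge0 br'.
have r0 : 0 < r' + 1 by lra.
have bh : normle h (r' + 1) by apply: normle_le br' _; lra.
move: (r' + 1) r0 bh => r r0 bh {r' br' r'0}.
split; first by rewrite ustarM sh.
exists (r ^+ 2); pose k := (r^-1)%:C%C *: h.
have bk : normle k 1.
  rewrite -(mulVf (lt0r_neq0 r0)); apply: normleZr => //.
  by rewrite invr_ge0 ltW.
have sk : k^† = k by rewrite ustar_real sh.
have hk : h * h = (r ^+ 2)%:C%C *: (k * k).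
  rewrite mulrZZ scalerA -!rmorphM /=.
  have -> : r ^+ 2 * (r^-1 * r^-1) = 1 by field; rewrite gt_eqF.
  by rewrite rmorph1 scale1r.
have [||l [sl l2 bl lC]] := @usqrt_one_minus (k * k).
- by rewrite ustarM sk.
- by have := normleM bk bk; rewrite mulr1.
have b1l : normle (1 - l) 1.
  apply: (@normle_cartesian _ k) => //; first by rewrite ustarB ustar1 sl.
    by rewrite mulrBr mulrBl mulr1 mul1r lC // mulrA.
  by rewrite l2 subrK expr1n rmorph1 scale1r.
rewrite hk -scalerBr -l2 -[r ^+ 2 in X in normle _ X]mulr1.
apply: normleZr; first exact: sqr_ge0.
by have := normleM b1l b1l; rewrite mulr1.
Qed.

(** If u = h^2 and -u = k^2, then h + i k has modulus 0, so h = -i k is both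
    self-adjoint and anti-self-adjoint. *)
Lemma upos_anti u : upos u -> upos (- u) -> u = 0.
Proof.
move=> /upos_sqrt[h [[sh _] hh hC]] /upos_sqrt[k [[sk _] kk kC]].
have kh : k * h = h * k.
  by apply: hC; apply: oppr_inj; rewrite -mulrN -mulNr -kk mulrA.
have : h + 'i *: k = 0.
  apply: normle_eq0; apply: normle_cstar => //.
  rewrite ustar_cartesian // hh kk subrr expr0n.
  exact: bd_zero (normle_banach B).
move=> hik; have : h - 'i *: k = 0.
  rewrite -scaleNr -conjCi -[in LHS]sk -ustarZ -[in LHS]sh -ustarD hik.
  exact: ustar0.
move=> /eqP; rewrite subr_eq0 => /eqP hk; move: hik; rewrite -hk => /eqP.
rewrite -mulr2n -scaler_nat scaler_eq0 pnatr_eq0 /= => /eqP h0.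
by rewrite -hh h0 mulr0.
Qed.

Lemma uposM u v : upos u -> upos v -> u * v = v * u -> upos (u * v).
Proof.
move=> /upos_sqrt[h [[sh _] hh hC]] /upos_sqrt[k [[sk _] kk kC]] uv.
have hv : h * v = v * h by rewrite hC.
have hk : h * k = k * h by apply: kC.
have -> : u * v = (h * k) * (h * k).
  by rewrite -hh -kk [RHS]mulrA -[h * k * h]mulrA -hk !mulrA.
by apply: upos_sqr; rewrite ustarM sh sk.
Qed.

Lemma normle_pow2 u r k : u^† = u -> 0 <= r ->
  normle (u ^+ (2 ^ k)) (r ^+ (2 ^ k)) -> normle u r.
Proof.
move=> su r0; elim: k => [|k IHk]; first by rewrite !expr1.
rewrite expnS mulnC !exprM => h; apply: IHk; apply: normle_cstar => //.
  exact: exprn_ge0.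
have -> : (u ^+ (2 ^ k))^† = u ^+ (2 ^ k).
  elim: (2 ^ k)%N => [|n IHn]; first exact: ustar1.
  by rewrite {1}exprS ustarM IHn su -exprSr.
by rewrite -expr2.
Qed.

(** With T = 1 - c d d^† and Z = 1 - c d^† d, the powers of Z are
    1 - c d^† (1 + T + ... + T^(n-1)) d. If |T| <= 1, they grow at most
    linearly, which for the self-adjoint Z is possible only if |Z| <= 1. *)
Lemma upos_mul_starC d : upos (d * d^†) -> upos (d^† * d).
Proof.
move=> /upos_gt0[t t0 bt]; split; first by rewrite ustarM ustarK.
exists t; pose c := (t^-1)%:C%C : K.
have tc : t%:C%C * c = 1 by rewrite -rmorphM mulfV ?gt_eqF // rmorph1.
have tinv0 : 0 <= t^-1 by rewrite invr_ge0 ltW.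
pose T := 1 - c *: (d * d^†); pose Z := 1 - c *: (d^† * d).
have bT : normle T 1.
  have -> : T = c *: (t%:U - d * d^†).
    by rewrite scalerBr scalerA [c * _]mulrC tc scale1r.
  by rewrite -(mulVf (lt0r_neq0 t0)); exact: normleZr.
have Zn n : Z ^+ n = 1 - c *: (d^† * (\sum_(i < n) T ^+ i) * d).
  elim: n => [|n IHn]; first by rewrite big_ord0 mulr0 mul0r scaler0 subr0.
  rewrite big_ord_recl expr0; under eq_bigr do rewrite lift0 exprSr.
  rewrite -mulr_suml exprSr IHn; set S := \sum_(i < n) _.
  have -> : d^† * (1 + S * T) * d =
      d^† * d + (d^† * S * d - c *: (d^† * S * d * (d^† * d))).
    rewrite /T mulrBr mulr1 -scalerAr mulrDr mulr1 mulrBr -scalerAr.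
    by rewrite mulrDl mulrBl -scalerAl !mulrA.
  rewrite /Z mulrBr mulr1 mulrBl mul1r mulrZZ opprB.
  rewrite !scalerDr scalerN scalerA !opprD opprK.
  by rewrite [LHS](AC (2*2) (1*(4*(2*3))))%AC.
have [r br] := normle_ex d; have r0 := normle_ge0 br.
have bZn n : normle (Z ^+ n) (1 + t^-1 * r ^+ 2 * n%:R).
  rewrite Zn; apply: normleB; first exact: normle1.
  rewrite -[t^-1 * _ * _]mulrA; apply: normleZr => //.
  have -> : r ^+ 2 * n%:R = r * n%:R * r by ring.
  apply: normleM => //; apply: normleM; first exact: normle_star.
  elim: n => [|n IHn].
    by rewrite big_ord0; exact: bd_zero (normle_banach B).
  rewrite big_ord_recr mulrSr; apply: normleD => //.
  elim: (n) => [|m IHm]; first exact: normle1.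
  by have := normleM bT IHm; rewrite mulr1 exprS.
have -> : t%:U - d^† * d = t%:C%C *: Z.
  by rewrite scalerBr scalerA tc scale1r.
rewrite -[t in X in normle _ X]mulr1; apply: normleZr; first exact: ltW.
apply: normle_limit => e e0.
have [k ke] := exp2_dominates_linear (t^-1 * r ^+ 2) e0.
apply: (@normle_pow2 _ _ k); last exact: normle_le (bZn _) ke.
  by rewrite ustarB ustar1 ustar_real ustarM ustarK.
lra.
Qed.

(** Let a = c^† c, let e = |a| - a be twice its negative part, and d = c e. Then
    d^† d = e a e <= 0, so that d d^† = 2 (Re(d)^2 + Im(d)^2) - d^† d >= 0. As
    d^† d >= 0 follows by exchanging the factors, d^† d = 0, hence e = 0. *)
Theorem upos_star_mul c : upos (c^† * c).
Proof.
set a := c^† * c; have sa : a^† = a by rewrite ustarM ustarK.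
(* m is the modulus |a|, and s its square root *)
have [m [pm mm mC]] := upos_sqrt (upos_sqr sa).
have am : a * m = m * a by apply: mC; rewrite mulrA.
have [s [[ss _] s2 sC]] := upos_sqrt pm.
have as_ : a * s = s * a by apply: sC.
have ms : m * s = s * m by rewrite -s2 mulrA.
have sm : m^† = m by case: pm.
pose e := m - a.
have se : e^† = e by rewrite ustarB sa sm.
have es : e * s = s * e by rewrite mulrBl mulrBr as_ ms.
have ae : a * e = - (m * e) by rewrite /e !mulrBr mm am opprB.
pose k := e * s; have sk : k^† = k by rewrite ustarM se ss -es.
pose d := c * e.
have dd : d^† * d = - (k * k).
  rewrite ustarM se mulrA -(mulrA e) -/a -mulrA ae mulrN -s2 /k.
  by rewrite {2}es !mulrA.
have pk := upos_sqr sk.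
have k0 : k * k = 0.
  apply: upos_anti => //; rewrite -dd; apply: upos_mul_starC.
  have -> : d * d^† = (2^-1)%:C%C *: ((d + d^†) * (d + d^†) +
      ('i *: (d - d^†)) * ('i *: (d - d^†))) + k * k.
    rewrite mulrZZ -['i * 'i]expr2 sqrCi scaleN1r -[k * k]opprK -dd.
    rewrite polarization_mul -[(_ + _) *+ 2]scaler_nat scalerA.
    rewrite -(rmorph_nat (real_complex R)) -rmorphM /= mulVf ?pnatr_eq0 //.
    by rewrite rmorph1 scale1r addrK.
  apply: uposD => //; apply: uposZ; first by rewrite invr_ge0.
  apply: uposD; apply: upos_sqr.
    by rewrite ustarD ustarK addrC.
  by rewrite ustarZ conjCi ustarB ustarK scaleNr -scalerN opprB.
have em : e * m = 0 by rewrite -s2 mulrA -/k (normle_sqr_eq0 sk k0) mul0r.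
have e0 : e = 0.
  apply: normle_sqr_eq0 => //.
  have mam : m * m = a * m by apply/eqP; rewrite -subr_eq0 -mulrBl -/e em.
  by rewrite {2}/e mulrBr em {1}/e mulrBl -am -mm mam subrr subr0.
by move/eqP: e0; rewrite subr_eq0 => /eqP <-.
Qed.

Lemma upos_conj v u : upos u -> upos (v^† * u * v).
Proof.
move=> /upos_sqrt[h [[sh _] <- _]].
by have := upos_star_mul (h * v); rewrite ustarM sh !mulrA.
Qed.

Lemma upos_sub_star_mul a r : normle a r -> upos ((r ^+ 2)%:U - a^† * a).
Proof.
move=> ba; have r0 := normle_ge0 ba; split.
  by rewrite ustarB ustar_real ustar1 ustarM ustarK.
exists (r ^+ 2); rewrite opprB addrC subrK expr2.
by apply: normleM => //; exact: normle_star.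
Qed.

(** Let x = a^† a and t = r^2. The product t^2 - x^2 of the commuting positive
    elements t - x and t + x is a square k^2, and |x| <= |x + i k| = t. *)
Lemma normle_of_upos a r :
  0 <= r -> upos ((r ^+ 2)%:U - a^† * a) -> normle a r.
Proof.
move=> r0; set x := a^† * a; set t := r ^+ 2 => px'.
have t0 : 0 <= t by exact: sqr_ge0.
have px : upos x by exact: upos_star_mul.
have sx : x^† = x by case: px.
have pt : upos t%:U.
  by rewrite -[1]mul1r; apply: uposZ => //; apply: upos_sqr; exact: ustar1.
have tx : t%:U * x = x * t%:U by rewrite -scalerAl -scalerAr mulr1 mul1r.
have prod : (t%:U - x) * (t%:U + x) = (t ^+ 2)%:U - x * x.
  rewrite mulrBl !mulrDr mulrZZ mulr1 -rmorphM -expr2 tx opprD addrA.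
  by rewrite addrK.
have [|k [[sk _] kk kC]] := @upos_sqrt ((t ^+ 2)%:U - x * x).
  rewrite -prod; apply: uposM => //; first exact: uposD.
  by rewrite mulrBl !mulrDr !mulrDl !mulrN tx opprD.
apply: normle_cstar => //; apply: (@normle_cartesian _ k) => //.
  apply: kC; rewrite mulrBr mulrBl -scalerAl -scalerAr mul1r mulr1.
  by rewrite mulrA.
by rewrite kk addrC subrK.
Qed.

End CStarPositivity.

(** * Linear identities *)

(** The extension of K by V with V^2 = 0 is a commutative ring, in which linear
    identities between vectors become ring identities and can be decided. *)
Definition trivext (K : comNzRingType) (V : lmodType K) : Type :=
  (K^o * V)%type.

Section TrivialExtension.
Variables (K : comNzRingType) (V : lmodType K).
Implicit Types u v w : trivext V.

HB.instance Definition _ := GRing.Zmodule.copy (trivext V) (K^o * V)%type.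

Definition trivext_mul u v : trivext V := (u.1 * v.1, u.1 *: v.2 + v.1 *: u.2).
Definition trivext_one : trivext V := (1, 0).

Let pairE u v : u.1 = v.1 -> u.2 = v.2 -> u = v.
Proof. by case: u v => [? ?] [? ?] /= -> ->. Qed.

Fact trivext_mulA : associative trivext_mul.
Proof.
move=> u v w; apply: pairE => /=; first exact: mulrA.
by rewrite !scalerDr !scalerA addrA (mulrC w.1 u.1) (mulrC w.1 v.1).
Qed.

Fact trivext_mulC : commutative trivext_mul.
Proof. by move=> u v; apply: pairE => /=; rewrite 1?mulrC 1?addrC. Qed.

Fact trivext_mul1u : left_id trivext_one trivext_mul.
Proof.
by move=> u; apply: pairE => /=; rewrite ?mul1r // scale1r scaler0 addr0.
Qed.

Fact trivext_mulDl : left_distributive trivext_mul +%R.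
Proof.
move=> u v w; apply: pairE => /=; first exact: mulrDl.
by rewrite scalerDl scalerDr addrACA.
Qed.

Fact trivext_one_neq0 : trivext_one != 0.
Proof. by apply/eqP => /(congr1 fst)/eqP; rewrite oner_eq0. Qed.

HB.instance Definition _ := GRing.Zmodule_isComNzRing.Build (trivext V)
  trivext_mulA trivext_mulC trivext_mul1u trivext_mulDl trivext_one_neq0.

Definition tvec (x : V) : trivext V := (0, x).
Definition tscal (k : K) : trivext V := (k, 0).

Fact tscal_additive : zmod_morphism tscal.
Proof. by move=> k l; apply: pairE => //=; rewrite subr0. Qed.

Fact tscal_multiplicative : monoid_morphism tscal.
Proof. by split=> // k l; apply: pairE => //=; rewrite !scaler0 addr0. Qed.

HB.instance Definition _ :=
  GRing.isZmodMorphism.Build K (trivext V) tscal tscal_additive.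
HB.instance Definition _ :=
  GRing.isMonoidMorphism.Build K (trivext V) tscal tscal_multiplicative.

Lemma tvecD x y : tvec (x + y) = tvec x + tvec y.
Proof. by apply: pairE => //=; rewrite addr0. Qed.

Lemma tvecN x : tvec (- x) = - tvec x.
Proof. by apply: pairE => //=; rewrite oppr0. Qed.

Lemma tvecZ k x : tvec (k *: x) = tscal k * tvec x.
Proof. by apply: pairE => /=; rewrite ?mulr0 // scaler0 addr0. Qed.

Lemma tvec_inj : injective tvec. Proof. by move=> x y []. Qed.

End TrivialExtension.

(** The vectors enter a linear identity as mere indeterminates. *)
Ltac module_ring := apply: tvec_inj; rewrite ?(tvecD, tvecN, tvecZ);
  repeat (match goal with |- context [tvec ?x] => move: (tvec x) => ? end);
  ring.

(** * Positive matrices *)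

Section MatrixSquareRoot.
Variables (R : realType) (B : cstarAlgType R[i]) (n : nat).
Local Notation K := R[i].
Local Notation U := (unitization B).
Local Notation "r %:U" := ((r%:C%C : R[i]) *: (1 : U))
  (at level 2, format "r %:U").
Implicit Types (X Y : 'M[U]_n) (v w : 'cV[U]_n) (r s t : R) (u : U).

Lemma ureal_mul r u : r%:U * u = r%:C%C *: u.
Proof. by rewrite -scalerAl mul1r. Qed.

Definition ip v w : U := \sum_k (v k 0)^† * w k 0.

Lemma ip_star v w : (ip v w)^† = ip w v.
Proof. by rewrite ustar_sum; apply: eq_bigr => k _; rewrite ustarM ustarK. Qed.

Lemma ipDr v w1 w2 : ip v (w1 + w2) = ip v w1 + ip v w2.
Proof. by rewrite -big_split; apply: eq_bigr => k _; rewrite mxE mulrDr. Qed.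

Lemma ipZr r v w : ip v (r%:U *: w) = r%:C%C *: ip v w.
Proof.
by rewrite scaler_sumr; apply: eq_bigr => k _; rewrite mxE ureal_mul scalerAr.
Qed.

Lemma ipDl v1 v2 w : ip (v1 + v2) w = ip v1 w + ip v2 w.
Proof. by rewrite -ip_star ipDr ustarD !ip_star. Qed.

Lemma ipZl r v w : ip (r%:U *: v) w = r%:C%C *: ip v w.
Proof. by rewrite -ip_star ipZr ustar_real ip_star. Qed.

Lemma ipNr v w : ip v (- w) = - ip v w.
Proof. by rewrite -sumrN; apply: eq_bigr => k _; rewrite mxE mulrN. Qed.

Lemma ipNl v w : ip (- v) w = - ip v w.
Proof. by rewrite -ip_star ipNr ustarN ip_star. Qed.

Let ipE := (ipDr, ipDl, ipNr, ipNl, ipZr, ipZl).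

Lemma upos_ip v : upos (ip v v).
Proof. by apply: upos_sum => k; exact: upos_star_mul. Qed.

Definition mstar X : 'M[U]_n := \matrix_(i, j) (X j i)^†.

Lemma ip_mul X v w : ip (mstar X *m v) w = ip v (X *m w).
Proof.
rewrite /ip; under eq_bigr do rewrite mxE ustar_sum mulr_suml.
rewrite exchange_big; apply: eq_bigr => i _ /=; rewrite mxE mulr_sumr.
by apply: eq_bigr => j _; rewrite mxE ustarM ustarK mulrA.
Qed.

Lemma mstarD X Y : mstar (X + Y) = mstar X + mstar Y.
Proof. by apply/matrixP => i j; rewrite !mxE ustarD. Qed.

Lemma mstarM X Y : mstar (X * Y) = mstar Y * mstar X.
Proof.
apply/matrixP => i j; rewrite !mxE ustar_sum; apply: eq_bigr => k _.
by rewrite !mxE ustarM.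
Qed.

Lemma mstarN X : mstar (- X) = - mstar X.
Proof. by apply/matrixP => i j; rewrite !mxE ustarN. Qed.

Lemma mstar1 : mstar 1 = 1.
Proof.
apply/matrixP => i j; rewrite !mxE eq_sym.
by case: eqP; rewrite ?ustar1 ?ustar0.
Qed.

Lemma mstar_realZ r X : mstar (r%:U *: X) = r%:U *: mstar X.
Proof. by apply/matrixP => i j; rewrite !mxE !ureal_mul ustar_real. Qed.

Lemma mul_realZ r X Y : X *m (r%:U *: Y) = r%:U *: (X *m Y).
Proof.
apply/matrixP => i j; rewrite !mxE mulr_sumr; apply: eq_bigr => k _.
by rewrite mxE !ureal_mul scalerAr.
Qed.

Lemma realZ_realZ r s X : r%:U *: (s%:U *: X) = (r * s)%:U *: X.
Proof. by rewrite scalerA ureal_mul scalerA -rmorphM. Qed.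

(** The operator norm on the column vectors. Comparing the inner products in the
    order of the algebra, rather than their norms, dispenses with the
    Cauchy-Schwarz inequality for the algebra-valued inner product. *)
Definition mnormle X r :=
  0 <= r /\ forall v, upos (r%:C%C ^+ 2 *: ip v v - ip (X *m v) (X *m v)).

Lemma mnormle_entry X r k l : mnormle X r -> normle (X k l) r.
Proof.
move=> [r0 /(_ (delta_mx l 0)) Xr]; apply: normle_of_upos => //.
rewrite rmorphXn /=.
have -> : r%:C%C ^+ 2 *: 1 - (X k l)^† * X k l =
    (r%:C%C ^+ 2 *: ip (delta_mx l 0) (delta_mx l 0) -
       ip (X *m delta_mx l 0) (X *m delta_mx l 0)) +
    \sum_(i | i != k) (X i l)^† * X i l.
  have -> : ip (delta_mx l 0) (delta_mx l 0) = 1.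
    rewrite /ip (bigD1 l) //= big1 => [|i il]; last first.
      by rewrite !mxE (negPf il) mulr0.
    by rewrite !mxE !eqxx mulr1 ustar1 addr0.
  rewrite -colE /ip (bigD1 k) //=.
  under [in RHS]eq_bigr do rewrite !mxE.
  by rewrite !mxE opprD addrA subrK.
apply: uposD => //; elim/big_rec: _ => [|i u _]; first exact: upos0.
by apply: uposD; exact: upos_star_mul.
Qed.

Lemma mnormle_eq0 X : mnormle X 0 -> X = 0.
Proof.
move=> X0; apply/matrixP => k l; rewrite mxE.
exact: normle_eq0 (mnormle_entry k l X0).
Qed.

Lemma mnormle_real r : 0 <= r -> mnormle (r%:U)%:M r.
Proof.
move=> r0; split=> // v; rewrite mul_scalar_mx !ipE scalerA -expr2 subrr.
exact: upos0.
Qed.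

Lemma mnormle_zero : mnormle 0 0.
Proof. by have := mnormle_real (lexx 0); rewrite scale0r raddf0. Qed.

Lemma mnormle_le X r s : mnormle X r -> r <= s -> mnormle X s.
Proof.
move=> [r0 Xr] rs; split=> [|v]; first exact: le_trans rs.
have -> : s%:C%C ^+ 2 *: ip v v - ip (X *m v) (X *m v) =
    (s ^+ 2 - r ^+ 2)%:C%C *: ip v v +
    (r%:C%C ^+ 2 *: ip v v - ip (X *m v) (X *m v)) by module_ring.
apply: uposD => //; apply: uposZ; last exact: upos_ip.
by rewrite subr_ge0 lerXn2r // nnegrE (le_trans r0).
Qed.

Lemma mnormleN X r : mnormle X r -> mnormle (- X) r.
Proof.
move=> [r0 Xr]; split; first exact: r0.
move=> v; have {Xr} := Xr v.
by rewrite mulNmx (ipNl (X *m v)) (ipNr (X *m v)) opprK.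
Qed.

(** The cross terms are absorbed by the square of s X v - r Y v. *)
Lemma mnormleD X Y r s : mnormle X r -> mnormle Y s -> mnormle (X + Y) (r + s).
Proof.
move=> Xr Ys; have [r0 _] := Xr; have [s0 _] := Ys.
move: r0; rewrite le_eqVlt => /orP[/eqP r0|r0].
  by move: Xr; rewrite -r0 => /mnormle_eq0 ->; rewrite !add0r.
move: s0; rewrite le_eqVlt => /orP[/eqP s0|s0].
  by move: Ys; rewrite -s0 => /mnormle_eq0 ->; rewrite !addr0.
split=> [|v]; first by rewrite addr_ge0 ?ltW.
apply: (uposZ_inv (mulr_gt0 r0 s0)).
rewrite mulmxDl; have {Xr} := Xr.2 v; have {Ys} := Ys.2 v.
move: (X *m v) (Y *m v) => a b Ys Xr.
have -> : (r * s)%:C%C *: ((r + s)%:C%C ^+ 2 *: ip v v - ip (a + b) (a + b)) =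
    (s * (r + s))%:C%C *: (r%:C%C ^+ 2 *: ip v v - ip a a) +
    (r * (r + s))%:C%C *: (s%:C%C ^+ 2 *: ip v v - ip b b) +
    ip (s%:U *: a - r%:U *: b) (s%:U *: a - r%:U *: b).
  by rewrite !ipE; module_ring.
have rs0 : 0 <= r + s by rewrite addr_ge0 ?ltW.
by do 2?apply: uposD; [| |exact: upos_ip]; apply: uposZ => //;
  rewrite mulr_ge0 // ltW.
Qed.

Lemma mnormleM X Y r s : mnormle X r -> mnormle Y s -> mnormle (X * Y) (r * s).
Proof.
move=> [r0 Xr] [s0 Ys]; split=> [|v]; first exact: mulr_ge0.
have {}Xr := Xr (Y *m v); rewrite -mulmxA.
have -> : (r * s)%:C%C ^+ 2 *: ip v v - ip (X *m (Y *m v)) (X *m (Y *m v)) =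
    (r ^+ 2)%:C%C *: (s%:C%C ^+ 2 *: ip v v - ip (Y *m v) (Y *m v)) +
    (r%:C%C ^+ 2 *: ip (Y *m v) (Y *m v) - ip (X *m (Y *m v)) (X *m (Y *m v))).
  by module_ring.
by apply: uposD => //; apply: uposZ => //; exact: sqr_ge0.
Qed.

(** For w = X^† v one has <w, w> = <X w, v>, whose comparison with <X w, X w>
    and <v, v> comes from the square of r^2 v - X w. *)
Lemma mnormle_star X r : mnormle X r -> mnormle (mstar X) r.
Proof.
move=> Xr; have [r0 _] := Xr.
move: r0; rewrite le_eqVlt => /orP[/eqP r0|r0].
  move: Xr; rewrite -r0 => /mnormle_eq0 ->; suff -> : mstar 0 = 0.
    exact: mnormle_zero.
  by apply/matrixP => i j; rewrite !mxE ustar0.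
split=> [|v]; first exact: ltW.
have r20 : 0 < r ^+ 2 by rewrite exprn_gt0.
apply: (uposZ_inv r20); have := ip_mul X v; set w := mstar X *m v => wE.
have -> : (r ^+ 2)%:C%C *: (r%:C%C ^+ 2 *: ip v v - ip w w) =
    (r%:C%C ^+ 2 *: ip w w - ip (X *m w) (X *m w)) +
    ip ((r ^+ 2)%:U *: v - X *m w) ((r ^+ 2)%:U *: v - X *m w).
  rewrite !ipE -[ip (X *m w) v]ip_star -!wE ip_star; module_ring.
by apply: uposD; [exact: Xr.2 | exact: upos_ip].
Qed.

Lemma mnormle_sum (F : 'I_n -> 'M[U]_n) r : (forall i, mnormle (F i) r) ->
  mnormle (\sum_i F i) (n%:R * r).
Proof.
move=> Fr; have -> : n%:R * r = \sum_(i < n) r.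
  by rewrite sumr_const card_ord mulr_natl.
elim/big_rec2: _ => [|i s Y _ Ys]; first exact: mnormle_zero.
exact: mnormleD (Fr i) Ys.
Qed.

Lemma mnormle_delta u r i j : normle u r -> mnormle (u *: delta_mx i j) r.
Proof.
move=> ur; split=> [|v]; first exact: normle_ge0 ur.
have -> : r%:C%C ^+ 2 *: ip v v -
      ip (u *: delta_mx i j *m v) (u *: delta_mx i j *m v) =
    (v j 0)^† * ((r ^+ 2)%:U - u^† * u) * v j 0 +
    \sum_(k | k != j) (r ^+ 2)%:C%C *: ((v k 0)^† * v k 0).
  have vE k : (u *: delta_mx i j *m v) k 0 = if k == i then u * v j 0 else 0.
    rewrite mxE (bigD1 j) //= big1 => [|l lj]; last first.
      by rewrite !mxE (negPf lj) andbF mulr0 mul0r.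
    rewrite !mxE eqxx andbT addr0.
    by case: eqP => _; rewrite ?mulr1 // mulr0 mul0r.
  rewrite [in X in _ - X]/ip (bigD1 i) //= big1 => [|k ki]; last first.
    by rewrite !vE (negPf ki) mulr0.
  rewrite !vE eqxx addr0 ustarM scaler_sumr (bigD1 j) //= rmorphXn /= addrAC.
  congr (_ + _); rewrite mulrBr mulrBl -scalerAr mulr1 -scalerAl.
  by rewrite !mulrA.
apply: uposD; first by apply: upos_conj; exact: upos_sub_star_mul.
elim/big_rec: _ => [|k w _ w0]; first exact: upos0.
by apply: uposD => //; apply: uposZ (upos_star_mul _); exact: sqr_ge0.
Qed.

Lemma mnormle_entries X r : (forall i j, normle (X i j) r) ->
  mnormle X (n%:R * (n%:R * r)).
Proof.
move=> Xr; rewrite [X]matrix_sum_delta.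
by do 2![apply: mnormle_sum => ?]; exact: mnormle_delta.
Qed.

Lemma mnormle_banach : banach_bound mnormle.
Proof.
split.
- by move=> X r [].
- exact: mnormle_le.
- exact: mnormle_zero.
- exact: mnormleD.
- exact: mnormleN.
- exact: mnormleM.
- move=> X; have /choice[b bX] :
      forall p : 'I_n * 'I_n, exists r, normle (X p.1 p.2) r.
    by move=> p; exact: normle_ex.
  exists (n%:R * (n%:R * \sum_p b p)); apply: mnormle_entries => i j.
  apply: (normle_le (bX (i, j))); rewrite (bigD1 (i, j)) //= lerDl sumr_ge0 //.
  by move=> p _; exact: normle_ge0 (bX p).
- move=> X X0; apply/matrixP => i j; rewrite mxE.
  apply: (bd_eq0 (normle_banach B)) => e /X0; exact: mnormle_entry.
- move=> F F_cauchy.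
  have /choice[l lF] : forall p : 'I_n * 'I_n, exists l : U, forall e, 0 < e ->
      exists N, forall m, (N <= m)%N -> normle (l - F m p.1 p.2) e.
    move=> p; apply: (normle_complete (u := fun m => F m p.1 p.2)) => e.
    move=> /F_cauchy[N FN].
    exists N => k m /FN/(mnormle_entry p.1 p.2); by rewrite !mxE.
  exists (\matrix_(i, j) l (i, j)) => e e0.
  pose d := e / (n%:R * n%:R + 1).
  have nn0 : 0 <= n%:R * n%:R :> R by rewrite mulr_ge0.
  have d0 : 0 < d by apply: divr_gt0 => //; lra.
  have /choice[N lN] p := lF p _ d0.
  exists (\max_p N p)%N => m mN.
  apply: (@mnormle_le _ (n%:R * (n%:R * d))).
    apply: mnormle_entries => i j; rewrite !mxE; apply: (lN (i, j)).
    by apply: leq_trans mN; exact: leq_bigmax.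
  rewrite mulrA -[leRHS](divfK (_ : n%:R * n%:R + 1 != 0)) ?gt_eqF //;
    last by lra.
  by rewrite -/d mulrC; move: (n%:R * n%:R) nn0 => N2; nra.
Qed.

(** After scaling, <v, X v> <= <v, v> for all v. For T = 1 - X, polarising the
    form of T at T v + v and T v - v gives <T v, T v> <= <v, v>, and the root is
    sqrt(1 - T). *)
Theorem matrix_sqrt X : mstar X = X -> (forall v, upos (ip v (X *m v))) ->
  exists C : 'M[U]_n, mstar C = C /\ C *m C = X.
Proof.
move=> sX pX; have [r' Xr'] := bd_ex mnormle_banach X.
have r'0 := Xr'.1; have [t t0 Xt] : exists2 t, 0 < t & mnormle X t.
  by exists (r' + 1); [lra | apply: mnormle_le Xr' _; lra].
have symX v w : ip (X *m v) w = ip v (X *m w) by rewrite -{1}sX ip_mul.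
have leX v : upos (t%:C%C *: ip v v - ip v (X *m v)).
  have t20 : 0 < 2 * t by lra.
  apply: (uposZ_inv t20).
  have -> : (2 * t)%:C%C *: (t%:C%C *: ip v v - ip v (X *m v)) =
      ip (t%:U *: v - X *m v) (t%:U *: v - X *m v) +
      (t%:C%C ^+ 2 *: ip v v - ip (X *m v) (X *m v)).
    by rewrite !ipE (symX v v); module_ring.
  by apply: uposD; [exact: upos_ip | exact: Xt.2].
pose T : 'M[U]_n := 1 - (t^-1)%:U *: X.
have TE v : T *m v = v - (t^-1)%:U *: (X *m v).
  by rewrite mulmxBl mul1mx scalemxAl.
have tinv : t%:C%C * (t^-1)%:C%C = 1 :> K.
  by rewrite -rmorphM mulfV ?gt_eqF // rmorph1.
have symT v w : ip (T *m v) w = ip v (T *m w) by rewrite !TE !ipE symX.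
have bT : mnormle T 1.
  split=> [|v]; first exact: ler01.
  rewrite rmorph1 expr1n scale1r.
  have h20 : 0 < 2 :> R by [].
  apply: (uposZ_inv h20); set w := T *m v.
  have -> : 2%:C%C *: (ip v v - ip w w) =
      (ip (w + v) (w + v) - ip (w + v) (T *m (w + v))) +
      (ip (w - v) (w - v) + ip (w - v) (T *m (w - v))).
    rewrite mulmxDr mulmxBr -/w !ipE -symT -/w -(symT v w) -/w; module_ring.
  apply: uposD; [move: (w + v) | move: (w - v)] => y.
    rewrite TE ipDr ipNr ipZr opprD opprK addrA subrr add0r.
    by apply: uposZ; [rewrite invr_ge0 ltW | exact: pX].
  rewrite TE ipDr ipNr ipZr; apply: (uposZ_inv t0).
  have -> : t%:C%C *: (ip y y + (ip y y - (t^-1)%:C%C *: ip y (X *m y))) =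
      t%:C%C *: ip y y + (t%:C%C *: ip y y - ip y (X *m y)).
    by rewrite !scalerDr scalerN scalerA tinv scale1r.
  apply: uposD; last exact: leX.
  by apply: uposZ; [exact: ltW | exact: upos_ip].
have halfM : ((2^-1)%:U)%:M + ((2^-1)%:U)%:M = 1 :> 'M[U]_n.
  by rewrite -raddfD /= half_add_half.
have bhalf : mnormle ((2^-1)%:U)%:M 2^-1.
  by apply: mnormle_real; rewrite invr_ge0.
have [l [l2 _ _ lstar]] := one_minus_sqrt mnormle_banach halfM bhalf bT.
have sl : mstar l = l.
  apply: (lstar mstar mstarD mstarM mnormle_star).
    apply/matrixP => i j; rewrite !mxE eq_sym; case: eqP => _.
      by rewrite !mulr1n ustar_real ustar1.
    by rewrite !mulr0n ustar0.
  by rewrite /T mstarD mstar1 mstarN mstar_realZ sX.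
exists ((Num.sqrt t)%:U *: (1 - l)); split.
  by rewrite mstar_realZ mstarD mstar1 mstarN sl.
rewrite -scalemxAl mul_realZ realZ_realZ -expr2 sqr_sqrtr ?ltW //.
have -> : (1 - l) *m (1 - l) = (t^-1)%:U *: X.
  by rewrite -[LHS]/((1 - l) * (1 - l)) l2 /T opprB addrC subrK.
by rewrite realZ_realZ mulfV ?gt_eqF // rmorph1 !scale1r.
Qed.

End MatrixSquareRoot.

(** * Positive conditional expectations *)

Section PositiveConditionalExpectation.
Variables (R : realType) (B : cstarAlgType R[i]) (A : starAlgType R[i]).
Variables (beta : B -> A) (Theta : A -> B).
Hypotheses (hbeta : star_hom beta) (hTheta : cond_exp beta Theta).
Hypothesis posTheta : positive_map Theta.

Lemma star_mul_eq0 (z : B) : star z ** z = 0 -> z = 0.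
Proof.
move=> z0; apply: rnorm_eq0; have := rnorm_star_mul z; rewrite z0 rnorm0.
by move/esym/eqP; rewrite sqrf_eq0 => /eqP ->.
Qed.

Lemma mul_eq0_faithful (y : B) : (forall b1 b2, b1 ** y ** b2 = 0) -> y = 0.
Proof.
move=> y0; apply: star_mul_eq0; apply: star_mul_eq0.
by rewrite starM starK; apply: y0.
Qed.

Let lT : linear Theta. Proof. by case: hTheta. Qed.
Let lb : linear beta. Proof. by case: hbeta => [[]]. Qed.
Let mb : {morph beta : x y / x ** y}. Proof. by case: hbeta => [[]]. Qed.
Let sb : {morph beta : x / star x}. Proof. by case: hbeta. Qed.
Let bimod b1 b2 x : Theta (beta b1 ** x ** beta b2) = b1 ** Theta x ** b2.
Proof. by case: hTheta. Qed.
Let unital b : Theta (beta b) = b. Proof. by case: hTheta. Qed.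

(** Only the two-sided bimodule property is given; the one-sided ones follow
    since the difference of both sides is killed by B on both sides. *)
Lemma cond_exp_mull b x : Theta (beta b ** x) = b ** Theta x.
Proof.
apply/eqP; rewrite -subr_eq0; apply/eqP; apply: mul_eq0_faithful => b1 b2.
rewrite numulDr numulDl numulxN numulNx -bimod !numulA -mb.
by rewrite bimod subrr.
Qed.

Lemma cond_exp_mulr b x : Theta (x ** beta b) = Theta x ** b.
Proof.
apply/eqP; rewrite -subr_eq0; apply/eqP; apply: mul_eq0_faithful => b1 b2.
rewrite numulDr numulDl numulxN numulNx -bimod !numulA.
by rewrite -(numulA _ (beta b)) -mb bimod !numulA subrr.
Qed.

(** Polarisation: the values at squares are self-adjoint. *)
Lemma cond_exp_star_mul x y :
  star (Theta (star x ** y)) = Theta (star y ** x).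
Proof.
have sa z : star (Theta (star z ** z)) = Theta (star z ** z).
  by have [c ->] := posTheta z; rewrite starM starK.
have TD := linear_mapD lT; have TZ := linear_mapZ lT.
have starN (K : numClosedFieldType) (C : starAlgType K) (z : C) :
    star (- z) = - star z.
  by rewrite -scaleN1r starZ rmorphN rmorph1 scaleN1r.
have := sa (x + y); have := sa (x + 'i *: y).
rewrite !starD !starZ conjCi !numulDl !numulDr -!nuscaleAl -!nuscaleAr.
rewrite !scaleNr scalerA -['i * 'i]expr2 sqrCi scaleN1r opprK.
have TN z : Theta (- z) = - Theta z by rewrite -scaleN1r TZ scaleN1r.
rewrite !(TD, TN, TZ) !(starD, starN, starZ) !sa conjCi.
have cancel (p q z w z' w' : B) :
    p + z + (w + q) = p + z' + (w' + q) -> z + w = z' + w'.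
  by rewrite !addrA => /addIr; rewrite -!addrA => /addrI.
set a := Theta (star x ** y); set b := Theta (star y ** x).
move=> /cancel h1 /cancel h2.
have {}h1 : star b - star a = a - b.
  have i0 : 'i != 0 :> R[i] by exact: neq0Ci.
  apply: (scalerI i0); rewrite !scalerBr addrC -h1.
  by rewrite !scaleNr opprK.
have ab2 : (2%:R : R[i]) *: star a = 2%:R *: b.
  rewrite !scaler_nat !mulr2n.
  transitivity (star a + star b - (star b - star a)).
    by rewrite opprB addrACA subrr addr0.
  by rewrite h2 h1 opprB [a + b]addrC addrACA subrr addr0.
have two_neq0 : (2%:R : R[i]) != 0 by rewrite pnatr_eq0.
exact: (scalerI two_neq0 ab2).
Qed.

(** Polarisation applies to products only, so x is first multiplied by an
    element of B, which can be moved out of Theta and cancelled. *)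
Lemma cond_exp_star x : Theta (star x) = star (Theta x).
Proof.
apply: (can_inj starK); rewrite [RHS]starK.
apply/eqP; rewrite -subr_eq0; apply/eqP; apply: mul_eq0_faithful => b1 b2.
suff h : b1 ** (star (Theta (star x)) - Theta x) = 0 by rewrite h numul0x.
rewrite numulDr numulxN -cond_exp_mull -[b1]starK [beta _]sb -cond_exp_star_mul.
by rewrite cond_exp_mulr starM subrr.
Qed.

Let ub := umap beta.
Let uT := umap Theta.

Lemma umap_cond_exp_mull u x : uT (ub u * x) = u * uT x.
Proof.
apply: unitization_eq => //=.
by rewrite !(linear_mapD lT) !(linear_mapZ lT) cond_exp_mull unital.
Qed.

Lemma umap_cond_exp_mulr u x : uT (x * ub u) = uT x * u.
Proof.
apply: unitization_eq => //=.
by rewrite !(linear_mapD lT) !(linear_mapZ lT) cond_exp_mulr unital.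
Qed.

Lemma umap_cond_exp_id u : uT (ub u) = u.
Proof. by apply: unitization_eq => //=. Qed.

Lemma umap_cond_exp_star x : uT x^† = (uT x)^†.
Proof. exact: (umap_star cond_exp_star). Qed.

Lemma umap_cond_exp_gram (I : Type) (r : seq I) (a : I -> unitization A)
    (c : I -> unitization B) :
  uT ((\sum_(k <- r) a k * ub (c k))^† * (\sum_(k <- r) a k * ub (c k))) =
  \sum_(k <- r) \sum_(l <- r) (c k)^† * uT ((a k)^† * a l) * c l.
Proof.
have uTsum (J : Type) (q : seq J) (f : J -> unitization A) :
    uT (\sum_(i <- q) f i) = \sum_(i <- q) uT (f i).
  exact: linear_map_sum (umap_linear lT) _ _ _.
have ubs : {morph ub : u / u^†} := umap_star sb.
rewrite ustar_sum mulr_suml uTsum; apply: eq_bigr => k _.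
rewrite mulr_sumr uTsum; apply: eq_bigr => l _.
rewrite ustarM -ubs -mulrA umap_cond_exp_mull mulrA umap_cond_exp_mulr.
by rewrite mulrA.
Qed.

Lemma umap_cond_exp_sum (I : Type) (r : seq I) (a : I -> unitization A)
    (c : I -> unitization B) :
  uT (\sum_(k <- r) a k * ub (c k)) = \sum_(k <- r) uT (a k) * c k.
Proof.
rewrite [LHS](linear_map_sum (umap_linear lT)); apply: eq_bigr => k _.
exact: umap_cond_exp_mulr.
Qed.

(** Kadison's inequality: the left-hand side is the value of Theta at y^† y
    for y = x - Theta(x), whose scalar part vanishes. *)
Lemma upos_variance x : upos (uT (x^† * x) - (uT x)^† * uT x).
Proof.
have TB : {morph uT : u v / u - v} := linear_mapB (umap_linear lT).
have ubM : {morph ub : u v / u * v} := umapM hbeta.1.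
have ubs : {morph ub : u / u^†} := umap_star sb.
set t := uT x; pose y := x - ub t.
have -> : uT (x^† * x) - t^† * t = uT (y^† * y).
  rewrite /y ustarB -ubs mulrBl !mulrBr -ubM !TB.
  rewrite umap_cond_exp_mull umap_cond_exp_mulr umap_cond_exp_id.
  by rewrite umap_cond_exp_star -/t subrr subr0.
have -> : y = uinj y.2 by apply: unitization_eq => //=; exact: subrr.
rewrite ustar_inj uinjM [uT _]umap_inj.
by have [c ->] := posTheta y.2; rewrite -uinjM -ustar_inj; exact: upos_star_mul.
Qed.

Lemma upos_umap_cond_exp x : upos (uT (x^† * x)).
Proof.
rewrite -[uT _](subrK ((uT x)^† * uT x)); apply: uposD.
  exact: upos_variance.
exact: upos_star_mul.
Qed.

End PositiveConditionalExpectation.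

(** * Generation of the amalgamated free product *)

Section Subalgebra.
Variables (K : numClosedFieldType) (A : nuAlgType K).

Record subalgebra := Subalgebra {
  subalg_mem :> A -> Prop;
  subalg0 : subalg_mem 0;
  subalg_linear : forall (k : K) x y,
    subalg_mem x -> subalg_mem y -> subalg_mem (k *: x + y);
  subalgM : forall x y, subalg_mem x -> subalg_mem y -> subalg_mem (x ** y)
}.

Variable S : subalgebra.

Definition subalg_pred : {pred A} := fun x => `[< S x >].

Fact subalg_submod_closed : submod_closed subalg_pred.
Proof.
split; first by apply/asboolP; exact: subalg0.
by move=> k x y /asboolP Sx /asboolP Sy; apply/asboolP; exact: subalg_linear.
Qed.

HB.instance Definition _ :=
  GRing.isSubmodClosed.Build K A subalg_pred subalg_submod_closed.

Record subalg_type := SubalgElt {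
  subalg_val : A; subalg_valP : subalg_val \in subalg_pred }.

HB.instance Definition _ := [isSub for subalg_val].
HB.instance Definition _ := [Choice of subalg_type by <:].
HB.instance Definition _ := [SubChoice_isSubLmodule of subalg_type by <:].

Definition subalg_elt x (Sx : S x) : subalg_type :=
  SubalgElt (introT (asboolP _) Sx : x \in subalg_pred).

Lemma subalg_mem_val (x : subalg_type) : S (val x).
Proof. by apply/asboolP; case: x. Qed.

Definition subalg_mul (x y : subalg_type) : subalg_type :=
  subalg_elt (subalgM (subalg_mem_val x) (subalg_mem_val y)).

Fact subalg_mulA : associative subalg_mul.
Proof. by move=> x y z; apply: val_inj; exact: numulA. Qed.
Fact subalg_mulDl : left_distributive subalg_mul +%R.
Proof. by move=> x y z; apply: val_inj; exact: numulDl. Qed.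
Fact subalg_mulDr : right_distributive subalg_mul +%R.
Proof. by move=> x y z; apply: val_inj; exact: numulDr. Qed.
Fact subalg_scaleAl (k : K) (x y : subalg_type) :
  k *: subalg_mul x y = subalg_mul (k *: x) y.
Proof. by apply: val_inj; exact: nuscaleAl. Qed.
Fact subalg_scaleAr (k : K) (x y : subalg_type) :
  k *: subalg_mul x y = subalg_mul x (k *: y).
Proof. by apply: val_inj; exact: nuscaleAr. Qed.

HB.instance Definition _ := Lmodule_isNUAlgebra.Build K subalg_type
  subalg_mulA subalg_mulDl subalg_mulDr subalg_scaleAl subalg_scaleAr.

End Subalgebra.

(** By the uniqueness part of the universal property, the composite of the
    induced map into a subalgebra S and of the inclusion of S is the identity. *)
Lemma amalgam_generated (K : numClosedFieldType) (B : cstarAlgType K)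
    (A_ : bool -> starAlgType K) (beta : forall j, B -> A_ j)
    (A : starAlgType K) (iota : forall j, A_ j -> A) (S : subalgebra A) :
  is_amalgamated_free_product beta iota ->
  (forall j x, S (iota j x)) -> forall a, S a.
Proof.
move=> [hiota agree univ] Siota a.
have [|b|g [hg giota _]] :=
    univ (subalg_type S) (fun j x => subalg_elt (Siota j x)).
- move=> j; have [[li mi] _] := hiota j; split=> [k x y|x y]; apply: val_inj.
    exact: li.
  exact: mi.
- by apply: val_inj; exact: agree.
have [|//|g' [_ _ uniq]] := univ A iota.
  by move=> j; case: (hiota j).
have hval : alg_hom (fun x => val (g x)).
  by have [lg mg] := hg; split=> [k x y|x y]; rewrite ?lg ?mg.
have hid : alg_hom (fun x : A => x) by [].
have val_g := uniq _ hval (fun j x => congr1 val (giota j x)) a.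
rewrite (uniq _ hid (fun _ _ => erefl) a) -val_g.
exact: subalg_mem_val.
Qed.

(** * Reduced words *)

Section Words.
Variables (K : numClosedFieldType) (A_ : bool -> starAlgType K).
Implicit Types s t : seq (letter A_).

(** Computed in the unitization so that the empty word has a product. *)
Definition wprod (C : nuAlgType K) (f : forall j, A_ j -> C) s :
    unitization C :=
  \prod_(l <- s) uinj (letter_map f l).

Lemma wprod_nil (C : nuAlgType K) (f : forall j, A_ j -> C) : wprod f [::] = 1.
Proof. exact: big_nil. Qed.

Lemma wprod_cons (C : nuAlgType K) (f : forall j, A_ j -> C) l s :
  wprod f (l :: s) = uinj (letter_map f l) * wprod f s.
Proof. exact: big_cons. Qed.

Lemma wprodE (C : nuAlgType K) (f : forall j, A_ j -> C) l s :
  wprod f (l :: s) = uinj (word_prod (letter_map f l) (map (letter_map f) s)).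
Proof.
rewrite wprod_cons; elim: s (letter_map f l) => [|m s IHs] x.
  by rewrite wprod_nil mulr1.
by rewrite wprod_cons mulrA uinjM IHs.
Qed.

Definition lstar (l : letter A_) : letter A_ :=
  existT _ (tag l) (star (tagged l)).

(** The word s^† t. *)
Fixpoint revstar s t :=
  if s is l :: s' then revstar s' (lstar l :: t) else t.

Lemma wprod_revstar (C : starAlgType K) (f : forall j, A_ j -> C) s t :
  (forall j, {morph @f j : x / star x}) ->
  wprod f (revstar s t) = (wprod f s)^† * wprod f t.
Proof.
move=> fs; elim: s t => [|l s IHs] t /=.
  by rewrite wprod_nil ustar1 mul1r.
by rewrite IHs !wprod_cons ustarM ustar_inj -mulrA /letter_map /= fs.
Qed.

Definition starts_off (j : bool) s := if s is m :: _ then j != tag m else true.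

Definition heads_differ s t :=
  if s is l :: _ then starts_off (tag l) t else true.

Variables (C : starAlgType K) (Psi_ : forall j, A_ j -> C).
Hypothesis Psi_star : forall j, {morph @Psi_ j : x / star x}.

(** Alternating words with centred letters, in a form suited to induction. *)
Fixpoint reduced s : Prop :=
  if s is l :: s' then
    [/\ letter_map Psi_ l = 0, starts_off (tag l) s' & reduced s']
  else True.

Lemma reduced_revstar s t : reduced s -> reduced t -> heads_differ s t ->
  reduced (revstar s t).
Proof.
elim: s t => [|l s IHs] t //= [psi_l off_s red_s] red_t off_t.
apply: IHs => //.
- split=> //; rewrite /letter_map /= Psi_star [X in star X]psi_l.
  by apply: uinj_inj; rewrite -ustar_inj uinj0 ustar0.
- by case: s off_s {red_s} => //= m s; rewrite eq_sym.
Qed.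

Lemma reduced_alternating s : reduced s -> alternating s.
Proof.
case: s => // l s; elim: s l => [|m s IHs] l //= [_ lm red_s].
by apply/andP; split=> //; exact: IHs.
Qed.

Lemma reduced_nth d s i : reduced s -> (i < size s)%N ->
  letter_map Psi_ (nth d s i) = 0.
Proof.
elim: s i => [|l s IHs] [|i] //= [psi_l _ red_s] //; exact: IHs.
Qed.

End Words.

(** * Conditionally free products *)

Section ConditionallyFree.
Variables (R : realType) (B : cstarAlgType R[i]).
Variables (A_ : bool -> starAlgType R[i]).
Variables (beta : forall j, B -> A_ j) (Phi_ Psi_ : forall j, A_ j -> B).
Variables (A : starAlgType R[i]) (iota : forall j, A_ j -> A) (Phi : A -> B).
Hypothesis hbeta : forall j, star_hom (beta j).
Hypothesis hPhi_ : forall j, cond_exp (beta j) (@Phi_ j).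
Hypothesis posPhi_ : forall j, positive_map (@Phi_ j).
Hypothesis hPsi_ : forall j, cond_exp (beta j) (@Psi_ j).
Hypothesis posPsi_ : forall j, positive_map (@Psi_ j).
Hypothesis hA : is_amalgamated_free_product beta iota.

Let emb (b : B) : A := @iota true (beta true b).

Hypothesis hPhi : cond_exp emb Phi.
Hypothesis moments : forall (l : letter A_) (s : seq (letter A_)),
  alternating (l :: s) ->
  (forall i, (i < size (l :: s))%N -> letter_map Psi_ (nth l (l :: s) i) = 0) ->
  Phi (word_prod (letter_map iota l) (map (letter_map iota) s)) =
  word_prod (letter_map Phi_ l) (map (letter_map Phi_) s).

Local Notation U := (unitization B).
Implicit Types (u c : U) (v w : unitization A) (s t : seq (letter A_)).

Let e : U -> unitization A := umap emb.
Let phi : unitization A -> U := umap Phi.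
Let inc j : unitization (A_ j) -> unitization A := umap (@iota j).
Let b j : U -> unitization (A_ j) := umap (beta j).
Let psi_ j : unitization (A_ j) -> U := umap (@Psi_ j).
Let phi_ j : unitization (A_ j) -> U := umap (@Phi_ j).
Let P := wprod iota.
Let F := wprod Phi_.
Let red := reduced Psi_.

Let iota_hom j : star_hom (@iota j). Proof. by case: hA. Qed.

Let emb_hom : star_hom emb.
Proof.
have [[li mi] si] := iota_hom true; have [[lb mb] sb] := hbeta true.
by split; [split=> [k x y|x y]; rewrite /emb ?lb ?li ?mb ?mi
  | move=> x; rewrite /emb sb si].
Qed.

Let eE j u : e u = inc (b j u).
Proof.
apply: unitization_eq => //=; rewrite /emb; case: hA => _ agree _.
by case: j; rewrite ?agree.
Qed.

Let eM : {morph e : u c / u * c}. Proof. exact: umapM emb_hom.1. Qed.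
Let e_star : {morph e : u / u^†}. Proof. exact: umap_star emb_hom.2. Qed.
Let e_lin : linear e. Proof. exact: umap_linear emb_hom.1.1. Qed.
Let e1 : e 1 = 1. Proof. exact: umap1 emb_hom.1.1. Qed.
Let incM j : {morph @inc j : x y / x * y}.
Proof. exact: umapM (iota_hom j).1. Qed.
Let inc_star j : {morph @inc j : x / x^†}.
Proof. exact: umap_star (iota_hom j).2. Qed.
Let inc_lin j : linear (@inc j).
Proof. exact: umap_linear (iota_hom j).1.1. Qed.
Let phi_lin : linear phi. Proof. by apply: umap_linear; case: hPhi. Qed.
Let phi_mull u w : phi (e u * w) = u * phi w.
Proof. exact: umap_cond_exp_mull. Qed.
Let phi_mulr u w : phi (w * e u) = phi w * u.
Proof. exact: umap_cond_exp_mulr. Qed.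
Let phi1 : phi 1 = 1. Proof. by apply: umap1; case: hPhi. Qed.
Let phi_e u : phi (e u) = u.
Proof. by rewrite -[e u]mulr1 phi_mull phi1 mulr1. Qed.
Let Psi_star j : {morph @Psi_ j : x / star x}.
Proof. by move=> x; exact: (cond_exp_star (hbeta j) (hPsi_ j)). Qed.
Let Phi_star j : {morph @Phi_ j : x / star x}.
Proof. by move=> x; exact: (cond_exp_star (hbeta j) (hPhi_ j)). Qed.

Let phiP s : red s -> phi (P s) = F s.
Proof.
case: s => [|l s] red_s; first by rewrite /P /F !wprod_nil phi1.
rewrite /P /F !wprodE [phi _]umap_inj moments //.
  exact: reduced_alternating red_s.
by move=> i; exact: reduced_nth red_s.
Qed.

(** Unlike phi (w^† v), the covariance vanishes on words with different first
    letters, which is what makes it suited to induction. *)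
Definition cov w v : U := phi (w^† * v) - (phi w)^† * phi v.

Let phiD := linear_mapD phi_lin.
Lemma covDl w1 w2 v : cov (w1 + w2) v = cov w1 v + cov w2 v.
Proof. by rewrite /cov ustarD mulrDl !phiD ustarD mulrDl opprD addrACA. Qed.

Lemma covDr w v1 v2 : cov w (v1 + v2) = cov w v1 + cov w v2.
Proof. by rewrite /cov mulrDr !phiD mulrDr opprD addrACA. Qed.

Lemma cov0l v : cov 0 v = 0.
Proof. by apply: (addrI (cov 0 v)); rewrite -covDl !addr0. Qed.

Lemma cov0r w : cov w 0 = 0.
Proof. by apply: (addrI (cov w 0)); rewrite -covDr !addr0. Qed.

Lemma cov_sum (I J : Type) (r : seq I) (q : seq J) f g :
  cov (\sum_(i <- r) f i) (\sum_(j <- q) g j) =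
  \sum_(i <- r) \sum_(j <- q) cov (f i) (g j).
Proof.
rewrite (big_morph (cov^~ _) (fun w1 w2 => covDl w1 w2 _) (cov0l _)).
by apply: eq_bigr => i _; rewrite (big_morph (cov _) (covDr _) (cov0r _)).
Qed.

Lemma cov_mull u w v : cov (e u * w) v = cov w (e u^† * v).
Proof. by rewrite /cov ustarM -e_star !phi_mull ustarM !mulrA. Qed.

Lemma cov_mulr u w v : cov w (v * e u) = cov w v * u.
Proof. by rewrite /cov mulrA !phi_mulr mulrBl mulrA. Qed.

Lemma cov_e_l u v : cov (e u) v = 0.
Proof. by rewrite /cov -e_star phi_mull phi_e subrr. Qed.

Lemma cov_words_differ s t : red s -> red t -> heads_differ s t ->
  cov (P s) (P t) = 0.
Proof.
move=> red_s red_t st; have iota_star j : {morph @iota j : x / star x}.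
  by case: (iota_hom j).
rewrite /cov -wprod_revstar // (phiP (reduced_revstar Psi_star red_s red_t st)).
by rewrite /F wprod_revstar // -/F (phiP red_s) (phiP red_t) subrr.
Qed.

Lemma cov_e_r u s : red s -> cov (P s) (e u) = 0.
Proof.
move=> red_s; rewrite -[e u]mul1r cov_mulr -[1](wprod_nil iota).
rewrite cov_words_differ //.
  by rewrite mul0r.
by case: s {red_s}.
Qed.

(** Split x^† y into a centred letter z and its expectation. Then s^† z t is again
    a reduced word, on which phi is multiplicative, while the expectation leaves
    the two shorter words. *)
Lemma cov_words_same j (x y : A_ j) s t :
  Psi_ x = 0 -> Psi_ y = 0 -> starts_off j s -> starts_off j t ->
  red s -> red t ->
  cov (inc (uinj x) * P s) (inc (uinj y) * P t) =
  (F s)^† *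
    (phi_ ((uinj x)^† * uinj y) - (phi_ (uinj x))^† * phi_ (uinj y)) * F t
  + cov (P s) (e (psi_ ((uinj x)^† * uinj y)) * P t).
Proof.
move=> psi_x psi_y off_s off_t red_s red_t.
have iota_star i : {morph @iota i : z / star z} by case: (iota_hom i).
have phi_word (z : A_ j) r : Psi_ z = 0 -> starts_off j r -> red r ->
    phi (inc (uinj z) * P r) = uinj (Phi_ z) * F r.
  move=> psi_z off_r red_r.
  have := phiP (s := existT _ j z :: r); rewrite /P /F !wprod_cons; apply.
  by split.
set p := (uinj x)^† * uinj y; set c := psi_ p.
have pE : p = uinj (star x ** y) by rewrite /p ustar_inj uinjM.
pose z := star x ** y - beta j (Psi_ (star x ** y)).
have [lPsi Psi_b] : linear (@Psi_ j) /\ (forall d, Psi_ (beta j d) = d).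
  by case: (hPsi_ j).
have psi_z : Psi_ z = 0 by rewrite /z (linear_mapB lPsi) Psi_b subrr.
have p_split : p = uinj z + b j c.
  have -> : b j c = uinj (beta j (Psi_ (star x ** y))) by rewrite /c pE.
  by rewrite pE /z uinjB subrK.
have phi_z : uinj (Phi_ z) = phi_ p - c.
  have [lPhi _ Phi_b] := hPhi_ j.
  by rewrite /z (linear_mapB lPhi) Phi_b uinjB /c pE.
have -> : cov (inc (uinj x) * P s) (inc (uinj y) * P t) =
    phi ((P s)^† * (inc (uinj z) * P t)) + phi ((P s)^† * (e c * P t)) -
    (F s)^† * ((phi_ (uinj x))^† * phi_ (uinj y)) * F t.
  rewrite /cov -phiD -mulrDr -mulrDl (eE j) -(linear_mapD (@inc_lin j)).
  rewrite -p_split.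
  rewrite /p incM inc_star ustarM !phi_word // ustarM !mulrA.
  by [].
have -> : phi ((P s)^† * (inc (uinj z) * P t)) =
    (F s)^† * (phi_ p - c) * F t.
  rewrite -phi_z; pose l : letter A_ := existT _ j z.
  have red_l : red (l :: t) by split.
  have st : heads_differ s (l :: t).
    by case: s off_s {red_s} => //= m s; rewrite eq_sym.
  have -> : inc (uinj z) * P t = P (l :: t) by rewrite /P wprod_cons.
  rewrite -wprod_revstar // (phiP (reduced_revstar Psi_star red_s red_l st)).
  by rewrite /F wprod_revstar // wprod_cons mulrA.
rewrite [in RHS]/cov phi_mull !(phiP red_s) (phiP red_t).
rewrite !mulrBr !mulrBl !mulrA.
set X1 := _ * phi_ p * _; set X2 := _ * c * _; set X3 := _ * phi_ _ * _.
set Y := phi _.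
by rewrite -!addrA; congr (_ + _); rewrite addrC -!addrA addrCA.
Qed.

(** A reduced word with first letter in A_j, split into that letter and the
    rest, so that the letter has the type A_j on the nose. *)
Definition jword j N :=
  {p : A_ j * seq (letter A_) |
    [/\ Psi_ p.1 = 0, starts_off j p.2, red p.2 & (size p.2 <= N)%N]}.

Let jval j N (p : jword j N) : unitization A :=
  inc (uinj (sval p).1) * P (sval p).2.

(** Coefficients from B are absorbed by the first letter. *)
Lemma split_first_letter N (I : Type) (r : seq I) (u : I -> U)
    (s : I -> seq (letter A_)) :
  (forall i, red (s i) /\ (size (s i) <= N.+1)%N) ->
  exists (u0 : U) (rt : seq (jword true N)) (rf : seq (jword false N)),
    \sum_(i <- r) e (u i) * P (s i) =
    e u0 + \sum_(p <- rt) jval p + \sum_(p <- rf) jval p.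
Proof.
move=> red_s.
have add_word j (p : jword j N) u0 (rt : seq (jword true N))
    (rf : seq (jword false N)) :
  exists u1 (rt1 : seq (jword true N)) (rf1 : seq (jword false N)),
    jval p + (e u0 + \sum_(q <- rt) jval q + \sum_(q <- rf) jval q) =
    e u1 + \sum_(q <- rt1) jval q + \sum_(q <- rf1) jval q
      :> unitization A.
  case: j p => p; [exists u0, (p :: rt), rf | exists u0, rt, (p :: rf)].
    by rewrite big_cons !addrA (addrC (jval p)).
  by rewrite big_cons [LHS]addrCA !addrA.
elim: r => [|i r [u0 [rt [rf IHr]]]].
  by exists 0, [::], [::]; rewrite !big_nil (linear_map0 e_lin) !addr0.
rewrite big_cons IHr; have := red_s i; case: (s i) => [|[j x] t] [/=].
  move=> _ _; exists (u i + u0), rt, rf.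
  by rewrite (linear_mapD e_lin) /P wprod_nil mulr1 !addrA.
move=> [psi_x off_t red_t] size_t.
pose x' := (b j (u i) * uinj x).2.
have psi_x' : Psi_ x' = 0.
  apply: uinj_inj; rewrite -[LHS]/(psi_ (uinj x')) /x' -umul_inj uinj0.
  rewrite [LHS](umap_cond_exp_mull (hbeta j) (hPsi_ j)) umap_inj.
  by rewrite [Psi_ x]psi_x uinj0 mulr0.
pose p : jword j N := exist _ (x', t) (And4 psi_x' off_t red_t size_t).
have -> : e (u i) * P (existT _ j x :: t) = jval p.
  rewrite /P wprod_cons mulrA (eE j) -[uinj (letter_map _ _)]/(inc (uinj x)).
  by rewrite -incM umul_inj.
exact: add_word.
Qed.

(** The first sum of the recursion is a variance of Phi_j. For the second one,
    the root C of the matrix of the psi_ (x_k^† x_l) turns it into covariances of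
    combinations of shorter words. *)
Lemma upos_cov_same_letter j N :
  (forall (I : Type) (r : seq I) (u : I -> U) (s : I -> seq (letter A_)),
    (forall i, red (s i) /\ (size (s i) <= N)%N) ->
    upos (cov (\sum_(i <- r) e (u i) * P (s i))
              (\sum_(i <- r) e (u i) * P (s i)))) ->
  forall r : seq (jword j N),
    upos (cov (\sum_(p <- r) jval p) (\sum_(p <- r) jval p)).
Proof.
move=> IHN r; rewrite big_tnth.
pose x k := uinj (sval (tnth (in_tuple r) k)).1.
pose t k := (sval (tnth (in_tuple r) k)).2.
have -> : \sum_(k < size r) jval (tnth (in_tuple r) k) =
    \sum_(k < size r) inc (x k) * P (t k) by [].
pose cov_j k l := phi_ ((x k)^† * x l) - (phi_ (x k))^† * phi_ (x l).
pose X : 'M[U]_(size r) := \matrix_(k, l) psi_ ((x k)^† * x l).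
have -> : cov (\sum_(k < size r) inc (x k) * P (t k))
      (\sum_(k < size r) inc (x k) * P (t k)) =
    \sum_k \sum_l (F (t k))^† * cov_j k l * F (t l) +
    \sum_k \sum_l cov (P (t k)) (e (X k l) * P (t l)).
  rewrite cov_sum -big_split; apply: eq_bigr => k _ /=.
  rewrite -big_split; apply: eq_bigr => l _ /=; rewrite mxE.
  case: (svalP (tnth (in_tuple r) k)) => psi_k off_k red_k _.
  case: (svalP (tnth (in_tuple r) l)) => psi_l off_l red_l _.
  exact: cov_words_same.
apply: uposD.
  pose y := \sum_k x k * b j (F (t k)).
  suff -> : \sum_k \sum_l (F (t k))^† * cov_j k l * F (t l) =
      phi_ (y^† * y) - (phi_ y)^† * phi_ y.
    exact: (upos_variance (hbeta j) (hPhi_ j) (@posPhi_ j)).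
  rewrite [phi_ (_ * _)](umap_cond_exp_gram (hbeta j) (hPhi_ j)).
  rewrite [phi_ y](umap_cond_exp_sum (hbeta j) (hPhi_ j)).
  rewrite ustar_sum mulr_suml -sumrB; apply: eq_bigr => k _.
  rewrite mulr_sumr -sumrB; apply: eq_bigr => l _.
  by rewrite /cov_j mulrBr mulrBl ustarM !mulrA.
have [|v|C [sC CC]] := @matrix_sqrt R B (size r) X.
- apply/matrixP => k l; rewrite !mxE.
  rewrite -[(psi_ _)^†](umap_cond_exp_star (hbeta j) (hPsi_ j)) //.
  by rewrite ustarM ustarK.
- pose y := \sum_k x k * b j (v k 0).
  suff -> : ip v (X *m v) = psi_ (y^† * y).
    exact: (upos_umap_cond_exp (hbeta j) (hPsi_ j) (@posPsi_ j)).
  rewrite [psi_ _](umap_cond_exp_gram (hbeta j) (hPsi_ j)).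
  apply: eq_bigr => k _; rewrite mxE mulr_sumr; apply: eq_bigr => l _.
  by rewrite mxE mulrA.
have -> : \sum_k \sum_l cov (P (t k)) (e (X k l) * P (t l)) =
    \sum_m cov (\sum_k e (C m k) * P (t k)) (\sum_k e (C m k) * P (t k)).
  under [RHS]eq_bigr do rewrite cov_sum.
  rewrite [RHS]exchange_big; apply: eq_bigr => k _ /=.
  rewrite [RHS]exchange_big; apply: eq_bigr => l _ /=.
  under eq_bigr do rewrite cov_mull mulrA -eM.
  rewrite -(big_morph (cov _) (covDr _) (cov0r _)) -mulr_suml.
  rewrite -(linear_map_sum e_lin) -CC mxE; congr (cov _ (e _ * _)).
  apply: eq_bigr => m _.
  by have -> : C k m = (C m k)^† by rewrite -[in LHS]sC mxE.
apply: upos_sum => m; apply: IHN => k.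
by case: (svalP (tnth (in_tuple r) k)) => _ _ red_k size_k.
Qed.

Lemma upos_cov_words N (I : Type) (r : seq I) (u : I -> U)
    (s : I -> seq (letter A_)) :
  (forall i, red (s i) /\ (size (s i) <= N)%N) ->
  upos (cov (\sum_(i <- r) e (u i) * P (s i))
            (\sum_(i <- r) e (u i) * P (s i))).
Proof.
elim: N I r u s => [|N IHN] I r u s red_s.
  have -> : \sum_(i <- r) e (u i) * P (s i) = e (\sum_(i <- r) u i).
    rewrite (linear_map_sum e_lin); apply: eq_bigr => i _.
    by case: (red_s i) => _; case: (s i) => // _; rewrite /P wprod_nil mulr1.
  by rewrite cov_e_l; exact: upos0.
have [u0 [rt [rf ->]]] := split_first_letter r u red_s.
have jvalE j (p : jword j N) : exists2 l : seq (letter A_),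
    red l /\ (forall i, starts_off i l = (i != j)) & jval p = P l.
  have [psi_x off_t red_t _] := svalP p.
  exists (existT _ j (sval p).1 :: (sval p).2); first by split; [split|].
  by rewrite /P wprod_cons.
have cross i j (p : jword i N) (q : jword j N) :
    i != j -> cov (jval p) (jval q) = 0.
  move=> ij; have [l [red_l off_l] ->] := jvalE _ p.
  have [m [red_m off_m] ->] := jvalE _ q; apply: cov_words_differ => //.
  case: l off_l {red_l} => // a l off_l; rewrite /= off_m.
  by have := off_l (tag a); rewrite /= eqxx => /esym/negbFE/eqP ->.
have cov_sum_e j (q : seq (jword j N)) : cov (\sum_(p <- q) jval p) (e u0) = 0.
  rewrite (big_morph (cov^~ _) (fun w1 w2 => covDl w1 w2 _) (cov0l _)).
  by apply: big1 => p _; have [l [red_l _] ->] := jvalE _ p; exact: cov_e_r.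
have cov_tf : cov (\sum_(p <- rt) jval p) (\sum_(p <- rf) jval p) = 0.
  by rewrite cov_sum; apply: big1 => p _; apply: big1 => q _; exact: cross.
have cov_ft : cov (\sum_(p <- rf) jval p) (\sum_(p <- rt) jval p) = 0.
  by rewrite cov_sum; apply: big1 => p _; apply: big1 => q _; exact: cross.
rewrite !covDl !covDr !cov_e_l !cov_sum_e cov_tf cov_ft !add0r addr0.
by apply: uposD; exact: upos_cov_same_letter.
Qed.

Definition word_span (w : unitization A) :=
  exists r : seq (U * {s | red s}), w = \sum_(p <- r) e p.1 * P (sval p.2).

Lemma word_span_word u s : red s -> word_span (e u * P s).
Proof. by move=> red_s; exists [:: (u, exist _ s red_s)]; rewrite big_seq1. Qed.

Lemma word_span0 : word_span 0.
Proof. by exists [::]; rewrite big_nil. Qed.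

Lemma word_spanD w v : word_span w -> word_span v -> word_span (w + v).
Proof. by move=> [r ->] [q ->]; exists (r ++ q); rewrite big_cat. Qed.

Lemma word_spanZ (k : R[i]) w : word_span w -> word_span (k *: w).
Proof.
move=> [r ->]; exists [seq (k *: p.1, p.2) | p <- r].
rewrite big_map scaler_sumr; apply: eq_bigr => p _ /=.
by rewrite (linear_mapZ e_lin) scalerAl.
Qed.

(** A letter from a factor other than that of the first letter of s is centred;
    otherwise it is first multiplied with the first letter. *)
Lemma word_span_letter j (x : A_ j) s : red s -> word_span (inc (uinj x) * P s).
Proof.
have off (z : A_ j) t :
    red t -> starts_off j t -> word_span (inc (uinj z) * P t).
  move=> red_t off_t.
  have [lPsi Psi_b] : linear (@Psi_ j) /\ (forall d, Psi_ (beta j d) = d).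
    by case: (hPsi_ j).
  have -> : inc (uinj z) * P t =
      e 1 * P (existT _ j (z - beta j (Psi_ z)) :: t) +
      e (uinj (Psi_ z)) * P t.
    rewrite e1 mul1r (eE j) /P wprod_cons -mulrDl; congr (_ * _).
    by rewrite -[uinj (letter_map _ _)]/(inc (uinj (z - beta j (Psi_ z))))
      -(linear_mapD (@inc_lin j)) [b j _]umap_inj -uinjD subrK.
  apply: word_spanD; apply: word_span_word => //; split=> //.
  by rewrite /letter_map /= (linear_mapB lPsi) Psi_b subrr.
case: s => [|[i y] t] red_s; first by apply: off.
have [ji|] := eqVneq j i; last by move=> ji; apply: off.
case: i / ji y red_s => y [_ off_t red_t].
rewrite /P wprod_cons mulrA -[uinj (letter_map _ _)]/(inc (uinj y)) -incM uinjM.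
exact: off.
Qed.

Lemma word_span_mul j (x : A_ j) w :
  word_span w -> word_span (inc (uinj x) * w).
Proof.
move=> [r ->]; rewrite mulr_sumr; elim: r => [|p r IHr].
  by rewrite big_nil; exact: word_span0.
rewrite big_cons; apply: word_spanD => //.
rewrite mulrA (eE j) -incM uinj_mul; apply: word_span_letter; exact: svalP.
Qed.

(** The elements whose left multiplication preserves the span of the words form
    a subalgebra containing both factors. *)
Lemma word_span_all (a : A) : word_span (uinj a).
Proof.
pose G (a : A) := forall w, word_span w -> word_span (uinj a * w).
have G0 : G 0 by move=> w _; rewrite uinj0 mul0r; exact: word_span0.
have Glin (k : R[i]) x y : G x -> G y -> G (k *: x + y).
  move=> Gx Gy w ws; rewrite uinjD uinjZ mulrDl -scalerAl.
  by apply: word_spanD; [apply: word_spanZ; exact: Gx | exact: Gy].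
have GM x y : G x -> G y -> G (x ** y).
  by move=> Gx Gy w ws; rewrite -uinjM -mulrA; apply: Gx; exact: Gy.
have Ga : G a.
  apply: (amalgam_generated (S := Subalgebra G0 Glin GM) hA) => j x w.
  exact: word_span_mul.
rewrite -[uinj a]mulr1; apply: Ga.
rewrite -[1]mulr1 -{1}e1 -(wprod_nil iota); exact: word_span_word.
Qed.

Theorem cond_free_positive (a : A) : cstar_ge0 (Phi (star a ** a)).
Proof.
have [r aE] := word_span_all a.
(* The root h of an element without scalar part has none either. *)
suff : upos (uinj (Phi (star a ** a))).
  move=> /upos_sqrt[h [[sh _] hh _]].
  have h1 : h.1 = 0.
    by have /eqP := congr1 fst hh; rewrite /= mulf_eq0 orbb => /eqP.
  exists h.2; apply: uinj_inj; rewrite -hh -uinjM -ustar_inj.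
  have -> : uinj h.2 = h by apply: unitization_eq.
  by rewrite sh.
rewrite -[uinj (Phi _)]/(phi (uinj (star a ** a))) -uinjM -ustar_inj.
set w := uinj a in aE *.
rewrite -[phi _](subrK ((phi w)^† * phi w)); apply: uposD;
  last exact: upos_star_mul.
rewrite -/(cov w w) aE big_tnth.
pose s k := sval (tnth (in_tuple r) k).2.
apply: (@upos_cov_words (\max_(k < size r) size (s k)) _ _ _ s) => k.
by split; [exact: svalP | exact: (leq_bigmax k)].
Qed.

End ConditionallyFree.

Theorem theorem6p5 (R : realType) (B : cstarAlgType R[i])
    (A_ : bool -> starAlgType R[i]) (beta : forall j, B -> A_ j)
    (Phi_ Psi_ : forall j, A_ j -> B)
    (hbeta : forall j, star_embedding (beta j))
    (hPhi_ : forall j, cond_exp (beta j) (Phi_ j) /\ positive_map (Phi_ j))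
    (hPsi_ : forall j, cond_exp (beta j) (Psi_ j) /\ positive_map (Psi_ j))
    (A : starAlgType R[i]) (iota : forall j, A_ j -> A) (Phi Psi : A -> B)
    (hA : is_cond_free_product beta Phi_ Psi_ iota Phi Psi) :
  (forall a : A, cstar_ge0 (Phi (star a ** a))) /\
  (forall a : A, cstar_ge0 (Psi (star a ** a))).
Proof.
have [amalg cPhi cPsi moments] := hA.
have hb j : star_hom (beta j) by case: (hbeta j).
split=> a.
  apply: (cond_free_positive hb (Phi_ := Phi_) (Psi_ := Psi_)
    (iota := iota)) => //.
  - by move=> j; case: (hPhi_ j).
  - by move=> j; case: (hPhi_ j).
  - by move=> j; case: (hPsi_ j).
  - by move=> j; case: (hPsi_ j).
  - by move=> l s alt_s psi_s; case: (moments l s alt_s psi_s).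
(* For Phi_ := Psi_ the product of the expectations of the letters is zero. *)
apply: (cond_free_positive hb (Phi_ := Psi_) (Psi_ := Psi_)
  (iota := iota)) => //.
- by move=> j; case: (hPsi_ j).
- by move=> j; case: (hPsi_ j).
- by move=> j; case: (hPsi_ j).
- by move=> j; case: (hPsi_ j).
- move=> l s alt_s psi_s; case: (moments l s alt_s psi_s) => -> _.
  have -> : letter_map Psi_ l = 0 by exact: (psi_s 0%N).
  elim: s {alt_s psi_s} => //= m s IHs.
  by rewrite /word_prod /= numul0x.
Qed.
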